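(* Let $r\in(\frac23,1)$. There is a constant $c_r>0$ depending only on $r$ such that every string graph with $m$ edges has an $r$-edge-balanced separator of size at most $c_r\sqrt{m}$. Furthermore, if $r>\frac34$, then every string graph with $m$ edges contains a set of at most $c_r\sqrt{m}$ vertices which is simultaneously a $\frac23$-balanced separator and an $r$-edge-balanced separator.
   Context: A string graph is the intersection graph of a finite collection of curves in the plane (vertices are the curves, two adjacent iff they intersect). For a graph $G=(V,E)$ and $\rho\in(0,1)$, a set $S\subset V$ is a $\rho$-balanced separator if there is a partition $V=V_1\cup V_2\cup S$ with no edge between $V_1$ and $V_2$ and $|V_1|,|V_2|\le \rho|V|$. A set $S\subset V$ is a $\rho$-edge-balanced separator if there is a partition $V=V_1\cup V_2\cup S$ with no edge between $V_1$ and $V_2$ such that the induced subgraphs $G[V_1]$ and $G[V_2]$ each have at most $\rho|E|$ edges.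
   Formalization: In the ''Furthermore'' part the one-vertex graph is excluded: there m = 0 forces the set to be empty, and then one part has 1 > 2/3 of a vertex, so no 2/3-balanced separator of size at most c_r√m exists. *)

(* Defs.v *)
From mathcomp Require Import all_boot all_order all_algebra.
From mathcomp Require Import all_classical all_reals all_analysis.

Set Implicit Arguments.
Unset Strict Implicit.
Unset Printing Implicit Defensive.

Import Order.TTheory GRing.Theory Num.Theory.
Import numFieldNormedType.Exports.

Local Open Scope ring_scope.

Record sgraph (V : finType) := SGraph {
  adj :> rel V;
  adj_sym : symmetric adj;
  adj_irr : irreflexive adj }.

(** A curve is a continuous image of [[0, 1]]; self-intersections are allowed.
    The curves form an indexed family, so two vertices may carry the same
    curve (and are then adjacent). *)
Definition is_curve (R : realType) (g : R -> R * R) : Prop :=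
  {within `[0, 1], continuous g}%classic.

Definition curve_support (R : realType) (g : R -> R * R) : set (R * R) :=
  (g @` `[0, 1])%classic.

Definition string_graph (R : realType) (V : finType) (G : sgraph V) : Prop :=
  exists g : V -> R -> R * R,
    (forall v, is_curve (g v)) /\
    (forall u v, G u v <->
       u <> v /\ (curve_support (g u) `&` curve_support (g v) !=set0)%classic).

Section Separators.
Variables (R : realType) (V : finType) (G : sgraph V).

(** Edges are unordered: each is the two-element set of its endpoints. *)
Definition induced_edges (A : {set V}) : {set {set V}} :=
  [set [set x; y] | x in A, y in A & G x y]%SET.

Definition edges : {set {set V}} := induced_edges [set: V]%SET.

(** The parts are allowed to be empty. *)
Definition separation (V1 V2 S : {set V}) : Prop :=
  [/\ (V1 :|: V2 :|: S)%SET = [set: V]%SET,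
      [disjoint V1 & V2], [disjoint V1 & S], [disjoint V2 & S]
    & {in V1 & V2, forall x y, ~~ G x y}].

Definition balanced_separator (rho : R) (S : {set V}) : Prop :=
  exists V1 V2 : {set V},
    [/\ separation V1 V2 S,
        #|V1|%:R <= rho * #|V|%:R & #|V2|%:R <= rho * #|V|%:R].

Definition edge_balanced_separator (rho : R) (S : {set V}) : Prop :=
  exists V1 V2 : {set V},
    [/\ separation V1 V2 S,
        #|induced_edges V1|%:R <= rho * #|edges|%:R
      & #|induced_edges V2|%:R <= rho * #|edges|%:R].

End Separators.

(* Main.v *)
(** A fine grid turns the curves into connected sets of grid vertices with the
    same intersection graph, and three disjoint connected sets of the grid cannot
    all be adjacent to three others (K33).

    Let m <= q^2. If no set of O(q) vertices halves a given vertex weight, every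
    small vertex set Z leaves a connected part beta(Z) with more than half of the
    weight. Grow a connected set U of grid points until about 200 q vertices are
    needed to cut it off from these parts, and let Z0 be a smallest cut. Few strings
    pass through a grid point, so U can be divided into three connected pieces,
    each still hard to separate from beta(Z0) locally. Weighting every vertex by its
    degree (total at most 2m), either O(q) vertices cut a piece off, or there is a
    connected part of beta(Z0) of weight O(q) linked to all three pieces. Its
    neighbourhood has only O(q) vertices; deleting it and repeating twice gives
    three separated parts, each linked to the three pieces: a K33, which is absurd.

    Halving repeatedly leaves components with at most 1/32 of the vertices and 1/32
    of the degree sum, and these can be distributed over two sides that are balanced
    for both measures. *)
Require Import Defs.
From mathcomp Require Import all_boot boolp zify.

Set Implicit Arguments.
Unset Strict Implicit.
Unset Printing Implicit Defensive.

(** Costs are counted in strings, never in grid points, since nothing bounds the size of the grid.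
    In the core argument the edge count enters through the degree sum, at most $2q^2$, in three
    ways: strings through one grid point form a clique, so there are at most [2 * q] of them; at
    most [2 * q] vertices have degree above [q]; and a search that pays [deg v] for passing [v] has
    a level of at most [q] vertices among its first [2 * q]. The obstacle is that a string linking
    to [U] may run on inside [U]. Hence only its portion outside [U], up to the arrival at a point
    of [U], goes into the link, and separation of a piece of [U] is measured by these arrivals
    ([land], [cutI]). Vertex sets turn into disjoint sets of grid points only if they are disjoint
    and no edge joins them, which is why whole neighbourhoods are deleted. The final ratio $5/8$ is
    below both $2/3$ and $r$, so one partition serves both assertions. *)

Lemma disjointsU (T : finType) (A B C : {set T}) :
  [disjoint A & C] -> [disjoint B & C] -> [disjoint A :|: B & C].
Proof. by rewrite -!setI_eq0 setIUl => /eqP-> /eqP->; rewrite setU0. Qed.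

Lemma card_bigcup_le (I T : finType) (P : pred I) (F : I -> {set T}) :
  #|\bigcup_(i | P i) F i| <= \sum_(i | P i) #|F i|.
Proof.
elim/big_rec2: _ => [|i n B _ le]; first by rewrite cards0.
by apply: leq_trans (leq_card_setU _ _) _; rewrite leq_add2l.
Qed.

Lemma mem_disjointF (T : finType) (A B : {set T}) x :
  [disjoint A & B] -> x \in A -> x \notin B.
Proof. by move=> /pred0P/(_ x)/= + xA; rewrite xA /= => ->. Qed.

Lemma not_disjoint (T : finType) (A B : {set T}) :
  ~ [disjoint A & B] -> exists2 x, x \in A & x \in B.
Proof.
by rewrite -setI_eq0 => /negP/set0Pn[x /setIP[xA xB]]; exists x.
Qed.

Lemma disjoint_intro (T : finType) (A B : {set T}) :
  (forall x, x \in A -> x \in B -> False) -> [disjoint A & B].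
Proof. by move=> H; apply: contrapT => /not_disjoint[x xA xB]; apply: H xA xB. Qed.

Lemma sum_subset (T : finType) (w : T -> nat) (A B : {set T}) :
  A \subset B -> \sum_(v in A) w v <= \sum_(v in B) w v.
Proof. by move=> AB; rewrite [leqRHS](big_setID A) (setIidPr AB) leq_addr. Qed.

Lemma sum_sub_total (T : finType) (w : T -> nat) (A : {set T}) :
  \sum_(v in A) w v <= \sum_v w v.
Proof. by rewrite [leqRHS](bigID (mem A)) leq_addr. Qed.

(** * Connected vertex sets *)

Section Connected.
Variables (T : finType) (e : rel T).

(** Path-free: a property holds on all of a connected [A] once it holds somewhere in [A] and spreads
    along the edges inside [A]. The empty set counts as connected. *)
Definition conn (A : {set T}) : Prop :=
  forall B : {set T}, B \subset A -> B != set0 ->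
    (forall x y, x \in B -> y \in A -> e x y -> y \in B) -> A \subset B.

Lemma conn0 : conn set0.
Proof. by move=> B _ _ _; apply: sub0set. Qed.

Lemma conn1 x : conn [set x].
Proof.
move=> B sB /set0Pn[y yB] _; apply/subsetP=> z /set1P->.
by have /set1P <- := subsetP sB y yB.
Qed.

(** Replaces walking along a path until it first leaves [B]. *)
Lemma conn_cross (A B : {set T}) x y : conn A -> B \subset A ->
  x \in B -> y \in A -> y \notin B ->
  exists a b, [/\ a \in B, b \in A, b \notin B & e a b].
Proof.
move=> cA sB xB yA yB; apply: contrapT => H.
have /subsetP/(_ y yA) : A \subset B; last by rewrite (negbTE yB).
apply: cA => //; first by apply/set0Pn; exists x.
move=> a b aB bA ab; apply: contrapT => /negP bB; apply: H.
by exists a, b.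
Qed.

Lemma conn_bigcup (P : pred {set T}) (A0 : {set T}) :
  (forall A, P A -> conn A) -> P A0 ->
  (forall A, P A -> A :&: A0 != set0) ->
  conn (\bigcup_(A | P A) A).
Proof.
move=> cP P0 meet C sC /set0Pn[c cC] clC.
have clA A : P A -> A :&: C != set0 -> A \subset C.
  move=> PA meetC; have sA : A \subset \bigcup_(A | P A) A.
    by apply: bigcup_sup.
  apply: subset_trans (subsetIr A C); apply: cP => //; first exact: subsetIl.
  move=> x y /setIP[xA xC] yA xy; rewrite inE yA /=.
  by apply: clC xy => //; apply: (subsetP sA).
have /bigcupP[A PA cA] := subsetP sC c cC.
have AC : A \subset C by apply: (clA) => //; apply/set0Pn; exists c; rewrite inE cA.
have A0C : A0 \subset C.
  apply: (clA) => //; have /set0Pn[x /setIP[xA x0]] := meet _ PA.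
  by apply/set0Pn; exists x; rewrite inE x0 (subsetP AC).
apply/bigcupsP => B PB; apply: clA => //.
have /set0Pn[x /setIP[xB x0]] := meet _ PB.
by apply/set0Pn; exists x; rewrite inE xB (subsetP A0C).
Qed.

Lemma connUI (A B : {set T}) : conn A -> conn B -> A :&: B != set0 ->
  conn (A :|: B).
Proof.
move=> cA cB AB.
have -> : A :|: B = \bigcup_(C | (C == A) || (C == B)) C.
  apply/setP=> x; apply/setUP/bigcupP => [[xA|xB]|[C /orP[]/eqP-> ?]].
  - by exists A; rewrite ?eqxx.
  - by exists B; rewrite ?eqxx ?orbT.
  - by left.
  - by right.
apply: (@conn_bigcup _ A) => [C /orP[]/eqP-> //||C /orP[]/eqP->]; rewrite ?eqxx //.
  by rewrite setIid; case/set0Pn: AB => x /setIP[xA _]; apply/set0Pn; exists x.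
by rewrite setIC.
Qed.

Hypothesis esym : symmetric e.

Lemma conn2 x y : e x y -> conn [set x; y].
Proof.
move=> exy B sB /set0Pn[z zB] cl.
have H : x \in B /\ y \in B.
  have /set2P[zE|zE] := subsetP sB z zB; rewrite zE in zB; split => //.
    by apply: (cl x) => //; rewrite !inE eqxx orbT.
  by apply: (cl y) => //; rewrite ?inE ?eqxx // esym.
by case: H => xB yB; apply/subsetP=> w /set2P[]->.
Qed.

Lemma connUe (A B : {set T}) x y : conn A -> conn B -> x \in A -> y \in B ->
  e x y -> conn (A :|: B).
Proof.
move=> cA cB xA yB exy.
have -> : A :|: B = (A :|: [set x; y]) :|: B.
  apply/setP=> z; rewrite !inE -!orbA; case: (eqVneq z x) => [->|_]; rewrite ?xA //.
  by case: (eqVneq z y) => [->|_] /=; rewrite ?yB ?orbT.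
apply: connUI => //; last by apply/set0Pn; exists y; rewrite !inE yB eqxx !orbT.
apply: connUI => //; first exact: conn2.
by apply/set0Pn; exists x; rewrite !inE xA eqxx.
Qed.

(** Empty when [x] lies outside [A]; connected in either case. *)
Definition component (A : {set T}) (x : T) : {set T} :=
  \bigcup_(B | `[< [/\ conn B, x \in B & B \subset A] >]) B.

Lemma sub_component (A B : {set T}) x : conn B -> x \in B -> B \subset A ->
  B \subset component A x.
Proof. by move=> cB xB BA; apply: bigcup_sup; apply/asboolP. Qed.

Lemma component_conn A x : conn (component A x).
Proof.
have [xA|xA] := boolP (x \in A); last first.
  rewrite /component big1 => [|B /asboolP[_ xB /subsetP/(_ x xB)]]; first exact: conn0.
  by rewrite (negbTE xA).
apply: (@conn_bigcup _ [set x]) => [B /asboolP[] //||B /asboolP[_ xB _]].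
  by apply/asboolP; split; [exact: conn1|rewrite inE|rewrite sub1set].
by apply/set0Pn; exists x; rewrite !inE xB eqxx.
Qed.

Lemma component_sub A x : component A x \subset A.
Proof. by apply/bigcupsP=> B /asboolP[]. Qed.

Lemma mem_component (A : {set T}) x : x \in A -> x \in component A x.
Proof.
move=> xA; have /subsetP : [set x] \subset component A x.
  by apply: sub_component; [exact: conn1|rewrite inE|rewrite sub1set].
by apply; rewrite inE.
Qed.

Lemma component_meet (A B : {set T}) x : x \in A -> conn B -> B \subset A ->
  B :&: component A x != set0 -> B \subset component A x.
Proof.
move=> xA cB BA BC; apply: subset_trans (subsetUl B (component A x)) _.
apply: sub_component; first by apply: connUI => //; exact: component_conn.
  by rewrite inE mem_component ?orbT.
by rewrite subUset BA component_sub.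
Qed.

Lemma component_adj (A : {set T}) x y z : y \in component A x -> z \in A -> e y z ->
  z \in component A x.
Proof.
move=> yC zA yz.
have xA : x \in A.
  have /bigcupP[B /asboolP[_ xB BA] _] := yC; exact: (subsetP BA).
have /subsetP : [set y; z] \subset component A x; last by apply; rewrite !inE eqxx orbT.
apply: component_meet => //; first exact: conn2.
  by apply/subsetP=> w /set2P[]-> //; exact: (subsetP (component_sub A x)).
by apply/set0Pn; exists y; rewrite !inE eqxx.
Qed.

Lemma conn_bigcup_point (I : finType) (F : I -> {set T}) x :
  (forall i, conn (F i)) -> (forall i, x \in F i) -> conn (\bigcup_i F i).
Proof.
move=> cF xF; have [i0 _|I0] := pickP I; last first.
  by rewrite big_pred0 //; exact: conn0.
have xU : x \in \bigcup_i F i by apply/bigcupP; exists i0.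
suff /eqP-> : \bigcup_i F i == component (\bigcup_i F i) x by exact: component_conn.
rewrite eqEsubset component_sub andbT; apply/bigcupsP=> i _.
by apply: sub_component => //; apply: bigcup_sup.
Qed.

(** A maximal connected proper subset [B] omits exactly one vertex: a vertex adjacent to [B] can be
    added to it, and by maximality the result is [A]. *)
Lemma conn_delete (A : {set T}) : conn A -> 1 < #|A| ->
  exists x, [/\ x \in A, conn (A :\ x) & exists2 y, y \in A :\ x & e x y].
Proof.
move=> cA A1; pose P B := `[< [/\ conn B, B != set0 & B \proper A] >].
have /card_gt0P[a aA] : 0 < #|A| by apply: ltn_trans A1.
have : P [set a].
  apply/asboolP; split; [exact: conn1| |].
    by apply/set0Pn; exists a; rewrite inE.
  rewrite properEcard sub1set aA cards1 //.
case/maxset_exists => B /maxsetP[/asboolP[cB /set0Pn[b bB] /properP[sB [c cA' cB']]] maxB] _.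
have [x [y [xB yA yB exy]]] := conn_cross cA sB bB cA' cB'.
have By : A = B :|: [set y].
  apply/eqP; rewrite eqEsubset andbC; apply/andP; split.
    by rewrite subUset sB sub1set.
  apply: contrapT => /negP nA; suff E : B :|: [set y] = B.
    by move: yB; rewrite -E !inE eqxx orbT.
  apply: maxB; last exact: subsetUl.
  apply/asboolP; split.
  - by apply: connUe exy => //; [exact: conn1|rewrite inE].
  - by apply/set0Pn; exists y; rewrite !inE eqxx orbT.
  - by rewrite properE nA subUset sB sub1set yA.
have AB : A :\ y = B.
  apply/setP=> z; rewrite By !inE; case: eqVneq => [->|] /=; rewrite ?(negbTE yB) ?orbF //.
by exists y; split; rewrite ?AB //; exists x => //; rewrite esym.
Qed.

End Connected.

(** * The grid has no K33 model *)

Section Tripod.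
Variables (T : finType) (e : rel T).
Hypothesis esym : symmetric e.

Definition touch (A B : {set T}) : Prop :=
  exists2 x, x \in A & exists2 y, y \in B & e x y.

Lemma touchS (A B C D : {set T}) : A \subset C -> B \subset D ->
  touch A B -> touch C D.
Proof.
move=> /subsetP AC /subsetP BD [x xA [y yB xy]].
by exists x; [exact: AC|exists y; [exact: BD|]].
Qed.

Lemma touchC (A B : {set T}) : touch A B -> touch B A.
Proof. by move=> [x xA [y yB xy]]; exists y => //; exists x => //; rewrite esym. Qed.

Lemma conn_touchU (A B : {set T}) : conn e A -> conn e B -> touch A B ->
  conn e (A :|: B).
Proof. by move=> cA cB [x xA [y yB xy]]; apply: connUe xy. Qed.

(* Remove from [C] one vertex at a time, keeping [C] connected, and give it to the
   set [B i] that touches [C] through this vertex only; if two of the [B i] need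
   it, it is [u], and the rest of [C] goes to the third. *)
Lemma shrink_to_vertex (C : {set T}) (B : 'I_3 -> {set T}) :
  conn e C -> (forall i, conn e (B i)) ->
  (forall i j, i != j -> [disjoint B i & B j]) ->
  (forall i, [disjoint C & B i]) -> (forall i, touch C (B i)) ->
  exists u (B' : 'I_3 -> {set T}),
    [/\ u \in C, forall i, conn e (B' i),
        forall i, [/\ u \notin B' i, B i \subset B' i & B' i \subset B i :|: C],
        forall i j, i != j -> [disjoint B' i & B' j]
      & forall i, touch [set u] (B' i)].
Proof.
have [n] := ubnP #|C|; elim: n C B => // n IH C B /ltnSE leCn cC cB dB dCB tCB.
have [x0 x0C _] := tCB ord0.
have [C1|C1] := leqP #|C| 1.
  have E : C = [set x0].
    by apply/eqP; rewrite eq_sym eqEcard sub1set x0C cards1.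
  exists x0, B; split=> // [i|i]; last by rewrite -E.
  split; rewrite ?subsetUl //.
  by have /pred0P/(_ x0)/= := dCB i; rewrite x0C /= => ->.
have [h [hC cD [y yD hy]]] := conn_delete esym cC C1.
set D := C :\ h in cD yD.
have DC : D \subset C by apply: subD1set.
have dDB i : [disjoint D & B i] by apply: disjointWl (dCB i).
have leD : #|D| < n by rewrite (cardsD1 h C) hC /= in leCn.
have hB i : h \notin B i.
  by have /pred0P/(_ h)/= := dCB i; rewrite hC /= => ->.
have hD : h \notin D by rewrite !inE eqxx.
have tor i : touch D (B i) \/ touch [set h] (B i).
  have [x xC [z zB xz]] := tCB i.
  have [xh|xh] := eqVneq x h; [right|left].
    by exists x; [rewrite inE xh|exists z].
  by exists x; [rewrite !inE xh|exists z].
have [[i0 ni0]|allD] := pselect (exists i, ~ touch D (B i)); last first.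
  have tD i : touch D (B i) by apply: contrapT => Hn; apply: allD; exists i.
  have [u [B' [uD cB' sB' dB' tB']]] := IH D B leD cD cB dB dDB tD.
  exists u, B'; split=> // [|i]; first exact: (subsetP DC).
  by have [? ? s] := sB' i; split=> //; apply: subset_trans s _; apply: setUS.
have hi0 : touch [set h] (B i0) by case: (tor i0).
have [[i1 [ni1 i10]]|others] := pselect (exists i, ~ touch D (B i) /\ i != i0).
  have hi1 : touch [set h] (B i1) by case: (tor i1).
  (* Both [B i0] and [B i1] touch [h], so at most the third set receives [D]; this keeps the new
     sets disjoint. *)
  pose B' i := if `[< touch [set h] (B i) >] then B i else B i :|: D.
  have B'0 i : touch [set h] (B i) -> B' i = B i by rewrite /B' => /asboolP->.
  have B'1 i : B' i = B i \/ [/\ i != i0, i != i1 & touch D (B i) /\ B' i = B i :|: D].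
    have [Hi|Hi] := pselect (touch [set h] (B i)); [left|right]; first exact: B'0.
    split; try by apply/eqP=> E; apply: Hi; rewrite E.
    by split; [case: (tor i)|rewrite /B'; case: asboolP].
  exists h, B'; split=> // [i|i|i j ij|i].
  - have [->//|[_ _ [tD ->]]] := B'1 i.
    by rewrite setUC; apply: conn_touchU.
  - have [->|[_ _ [_ ->]]] := B'1 i; first by split; rewrite ?subsetUl.
    by rewrite inE (negbTE (hB i)) (negbTE hD); split; rewrite ?subsetUl ?setUS.
  - have [->|[ni ni' [_ ->]]] := B'1 i; have [->|[nj nj' [_ ->]]] := B'1 j.
    + exact: dB.
    + by rewrite disjoint_sym; apply: disjointsU => //; apply: dB; rewrite eq_sym.
    + by apply: disjointsU => //; apply: dB.
    + exfalso; clear -ni ni' nj nj' ij i10.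
      case: i i0 i1 j ni ni' nj nj' ij i10 => [a ?] [b ?] [c ?] [d ?].
      by rewrite -!val_eqE /=; lia.
  - have [Hi|Hi] := pselect (touch [set h] (B i)); first by rewrite B'0.
    rewrite /B'; case: asboolP => // _.
    by exists h; rewrite ?inE //; exists y; rewrite // inE yD orbT.
pose B2 i := if i == i0 then B i :|: [set h] else B i.
have tD2 i : touch D (B2 i).
  rewrite /B2; have [->|ni] := eqVneq i i0.
    by exists y => //; exists h; rewrite ?inE ?eqxx ?orbT // esym.
  by apply: contrapT => Hn; apply: others; exists i.
have [|i j ij|i|u [B' [uD cB' sB' dB' tB']]] := IH D B2 leD cD _ _ _ tD2.
- move=> i; rewrite /B2; case: eqVneq => [->|//].
  by apply: conn_touchU => //; [exact: conn1|apply: touchC].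
- rewrite /B2; have [Ei|_] := eqVneq i i0; have [Ej|_] := eqVneq j i0.
  + by case/eqP: ij; rewrite Ei Ej.
  + by apply: disjointsU; [exact: dB|rewrite disjoints1].
  + by rewrite disjoint_sym; apply: disjointsU; [apply: dB; rewrite eq_sym|rewrite disjoints1].
  + exact: dB.
- rewrite /B2; case: eqVneq => // _.
  by rewrite disjoint_sym; apply: disjointsU; [rewrite disjoint_sym|rewrite disjoints1].
exists u, B'; split=> // [|i]; first exact: (subsetP DC).
have [? s s'] := sB' i; split=> //.
  by apply: subset_trans s; rewrite /B2; case: (i == i0); rewrite ?subsetUl.
apply: subset_trans s' _; rewrite /B2; apply/subsetP=> z; case: (i == i0); rewrite !inE.
  by case/orP=> [/orP[->//|/eqP->]|/andP[_ ->]]; rewrite ?hC ?orbT.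
by case/orP=> [->//|/andP[_ ->]]; rewrite orbT.
Qed.

End Tripod.

(** * Cycles modulo 2 in the grid and the parity of enclosure *)

Section Grid.
Variable N : nat.
Local Notation P := ('I_N * 'I_N)%type.

Definition gadj (p q : P) : bool :=
  (p.2 == q.2 :> nat) && ((p.1.+1 == q.1 :> nat) || (q.1.+1 == p.1 :> nat))
  || (p.1 == q.1 :> nat) && ((p.2.+1 == q.2 :> nat) || (q.2.+1 == p.2 :> nat)).

Lemma gadj_sym : symmetric gadj.
Proof. by move=> p q; rewrite /gadj; lia. Qed.

(* A chain modulo 2: [c true i j] is the edge from (i,j) to (i+1,j) and
   [c false i j] the edge from (i,j) to (i,j+1); the vertex [p] sits at
   (p.1+1, p.2+1), so that no edge of a chain of [P] has a coordinate 0. *)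
Definition chain := bool -> nat -> nat -> bool.

Definition addc (c d : chain) : chain := fun b i j => c b i j (+) d b i j.

Definition csupp (c : chain) (A : {set P}) : Prop :=
  forall b i j, c b i j -> exists p q : P,
    [/\ p \in A, q \in A, p.1.+1 = i /\ p.2.+1 = j
      & q.1 = p.1 + b :> nat /\ q.2 = p.2 + ~~ b :> nat].

(** The boundary modulo 2: the parity of the chain edges at the grid vertex [(i, j)], which sits at
    [(i+1, j+1)] in chain coordinates. *)
Definition bd (c : chain) i j : bool :=
  (c true i.+1 j.+1 (+) c true i j.+1) (+) (c false i.+1 j.+1 (+) c false i.+1 j).

Definition delta (p : P) i j : bool := (p.1 == i :> nat) && (p.2 == j :> nat).

Lemma csupp_addc c d A : csupp c A -> csupp d A -> csupp (addc c d) A.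
Proof.
move=> sc sd b i j; rewrite /addc; case E: (c b i j) => /=; first by move=> _; apply: sc.
exact: sd.
Qed.

Lemma csuppS c (A B : {set P}) : A \subset B -> csupp c A -> csupp c B.
Proof.
move=> /subsetP AB sc b i j /sc[p [q [pA qA ? ?]]].
by exists p, q; split; auto.
Qed.

Lemma bd_addc c d i j : bd (addc c d) i j = bd c i j (+) bd d i j.
Proof.
rewrite /bd /addc; case: (c true i.+1 j.+1); case: (c true i j.+1);
case: (c false i.+1 j.+1); case: (c false i.+1 j);
case: (d true i.+1 j.+1); case: (d true i j.+1);
by case: (d false i.+1 j.+1); case: (d false i.+1 j).
Qed.

Definition echain (a b : P) : chain := fun d i j =>
  if d then [&& a.2 == b.2 :> nat, (minn a.1 b.1).+1 == i & a.2.+1 == j]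
  else [&& a.1 == b.1 :> nat, a.1.+1 == i & (minn a.2 b.2).+1 == j].

Lemma echain_supp a b : gadj a b -> csupp (echain a b) [set a; b].
Proof.
move=> ab [] i j /= /and3P[/eqP ? /eqP ? /eqP ?];
  move: ab; rewrite /gadj => ab.
- have [lt|ge] := ltnP a.1 b.1.
    by exists a, b; rewrite !inE !eqxx ?orbT /=; split=> //; split; lia.
  by exists b, a; rewrite !inE !eqxx ?orbT /=; split=> //; split; lia.
- have [lt|ge] := ltnP a.2 b.2.
    by exists a, b; rewrite !inE !eqxx ?orbT /=; split=> //; split; lia.
  by exists b, a; rewrite !inE !eqxx ?orbT /=; split=> //; split; lia.
Qed.

Lemma echain_bd a b i j : gadj a b -> bd (echain a b) i j = delta a i j (+) delta b i j.
Proof.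
rewrite /gadj /bd /echain /delta !eqSS => /orP[]/andP[/eqP e2 /orP[]/eqP e1].
all: case: a b e1 e2 => [[a1 ?] [a2 ?]] [[b1 ?] [b2 ?]] /= e1 e2; subst.
all: rewrite ?eqxx /=.
all: lia.
Qed.

Lemma chain_exists (A : {set P}) x y : conn gadj A -> x \in A -> y \in A ->
  exists c, csupp c A /\ forall i j, bd c i j = delta x i j (+) delta y i j.
Proof.
move=> cA xA yA.
pose B := [set y in A | `[< exists c, csupp c A /\
  forall i j, bd c i j = delta x i j (+) delta y i j >]].
have /subsetP/(_ y yA) : A \subset B; last by rewrite inE => /andP[_ /asboolP].
apply: cA.
- by apply/subsetP=> z; rewrite inE => /andP[].
- apply/set0Pn; exists x; rewrite inE xA; apply/asboolP.
  by exists (fun _ _ _ => false); split=> // i j; rewrite addbb.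
move=> a b; rewrite inE => /andP[aA /asboolP[c [sc bc]]] bA ab.
rewrite inE bA; apply/asboolP; exists (addc c (echain a b)); split.
  apply: csupp_addc => //; apply: csuppS (echain_supp ab).
  by rewrite subUset !sub1set aA.
by move=> i j; rewrite bd_addc bc echain_bd // addbA addbK.
Qed.

(* The value on the unit square with lower left corner (i,j): the parity of
   the horizontal edges of [c] below it. *)
Fixpoint face (c : chain) i j : bool :=
  if j is k.+1 then face c i k (+) c true i j else c true i 0.

Lemma face_addc c d i j : face (addc c d) i j = face c i j (+) face d i j.
Proof.
elim: j => [|j IH] //=; rewrite IH /addc.
by case: (face c i j); case: (face d i j); case: (c _ _ _); case: (d _ _ _).
Qed.

Lemma csupp0 c A b i j : csupp c A -> (i == 0) || (j == 0) -> c b i j = false.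
Proof.
move=> sc ij; apply: contrapT; move/eqP; rewrite eqbF_neg negbK => /sc.
by move=> [p [q [_ _ [pi pj] _]]]; move: ij; rewrite -pi -pj.
Qed.

(** Squares on the two sides of a vertical edge differ by that edge. Going up one row changes the
    two column counts by the horizontal edges at one vertex, and these have the same parity as the
    two vertical edges there. The induction starts in row 0, where the chain has no edge. *)
Lemma face_step c A i j : csupp c A -> (forall i j, bd c i j = false) ->
  face c i.+1 j = face c i j (+) c false i.+1 j.
Proof.
move=> sc bc; elim: j => [|j IH] /=.
  by rewrite !(csupp0 _ sc) // orbT.
have := bc i j; rewrite /bd IH.
by case: (c true i.+1 j.+1); case: (c true i j.+1); case: (c false i.+1 j.+1);
   case: (c false i.+1 j); case: (face c i j).
Qed.

Definition avoids (c : chain) (p : P) : Prop :=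
  [/\ c true p.1.+1 p.2.+1 = false, c true p.1 p.2.+1 = false,
      c false p.1.+1 p.2.+1 = false & c false p.1.+1 p.2 = false].

Lemma eqP_nat (p q : P) : p.1 = q.1 :> nat -> p.2 = q.2 :> nat -> p = q.
Proof. by case: p q => [a b] [c d] /= /val_inj-> /val_inj->. Qed.

Lemma csupp_avoids c A p : csupp c A -> p \notin A -> avoids c p.
Proof.
move=> sc pA.
have no b i j : c b i j ->
    (i = p.1.+1 /\ j = p.2.+1) \/ (i + b = p.1.+1 /\ j + ~~ b = p.2.+1) -> False.
  move=> /sc[a [a' [aA a'A [ai aj] [a'i a'j]]]] [[pi pj]|[pi pj]].
    have E : p = a by apply: eqP_nat; apply: succn_inj; rewrite ?ai ?aj ?pi ?pj.
    by rewrite E aA in pA.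
  have E : p = a'.
    by apply: eqP_nat; apply: succn_inj; rewrite ?a'i ?a'j -?pi -?pj -?ai -?aj ?addSn.
  by rewrite E a'A in pA.
split; apply/negP=> /no; apply; [left|right|left|right]; rewrite /= ?addn0 ?addn1 //.
Qed.

(** A vertex is read off at the square whose lower left corner it is. A step right or up crosses an
    edge at [q], absent from [c]; a step left or down crosses the upward or rightward edge at [p],
    which stays as a correction because [p] may lie on the cycle. *)
Lemma face_nbr c A p q : csupp c A -> (forall i j, bd c i j = false) ->
  gadj p q -> avoids c q ->
  face c q.1.+1 q.2.+1 = face c p.1.+1 p.2.+1
    (+) (q.1 < p.1) && c false p.1.+1 p.2.+1
    (+) (q.2 < p.2) && c true p.1.+1 p.2.+1.
Proof.
move=> sc bc pq [c1 c2 c3 c4].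
have fs i j := face_step i j sc bc.
move: pq; rewrite /gadj => /orP[]/andP[/eqP e2 /orP[]/eqP e1].
- rewrite -e1 fs -e2 !ltnn ltnNge leqnSn /= e1 e2 c3.
  by rewrite !addbF -e2.
- rewrite -e1 (fs q.1.+1) e2 !ltnn ltnSn /= addbF.
  by rewrite -addbA addbb addbF.
- rewrite -e1 -e2 in c1 *; rewrite ltnn ltnNge leqnSn !addbF.
  by rewrite [LHS]/= c1 addbF.
- rewrite -e1 -e2 ltnn ltnSn addbF.
  by rewrite [face c p.1.+1 q.2.+2]/= -addbA addbb addbF.
Qed.

Lemma face_const c A (B : {set P}) x y : csupp c A ->
  (forall i j, bd c i j = false) -> conn gadj B -> [disjoint A & B] ->
  x \in B -> y \in B -> face c x.1.+1 x.2.+1 = face c y.1.+1 y.2.+1.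
Proof.
move=> sc bc cB dAB xB yB.
pose C := [set y in B | face c x.1.+1 x.2.+1 == face c y.1.+1 y.2.+1].
have cl z : z \in B -> avoids c z.
  move=> zB; apply: csupp_avoids sc _.
  by have /pred0P/(_ z)/= := dAB; rewrite zB andbT => ->.
have /subsetP/(_ y yB) : B \subset C; last by rewrite inE => /andP[_ /eqP].
apply: cB.
- by apply/subsetP=> z; rewrite inE => /andP[].
- by apply/set0Pn; exists x; rewrite inE xB eqxx.
move=> a b; rewrite inE => /andP[aB /eqP E] bB ab; rewrite inE bB E andTb.
have [a1 _ a2 _] := cl a aB.
by rewrite (face_nbr sc bc ab (cl b bB)) a1 a2 !andbF !addbF.
Qed.

(* Shrink [A ord0] to a vertex [u]; let P_i be a path from [u] through [B i] to
   a vertex [v] of [A 1], and F_ij(x) the parity with which the closed walk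
   P_i + P_j surrounds a point [x] off it, so that F_01 + F_02 + F_12 = 0. A point
   of [A 2] is on the same side of P_i + P_j as the neighbour b_k of [u] on P_k,
   hence F_01(b_2) + F_02(b_1) + F_12(b_0) = 0. But of three edges leaving [u],
   exactly one lies inside the angle formed by the other two, which gives 1. *)
Lemma grid_K33_free (A B : 'I_3 -> {set P}) :
  (forall i, conn gadj (A i)) -> (forall i, conn gadj (B i)) ->
  (forall i j, i != j -> [disjoint A i & A j]) ->
  (forall i j, i != j -> [disjoint B i & B j]) ->
  (forall i j, [disjoint A i & B j]) ->
  (forall i j, touch gadj (A i) (B j)) -> False.
Proof.
move=> cA cB dA dB dAB tAB.
have [u [B' [uA cB' sB' dB' tB']]] :=
  shrink_to_vertex gadj_sym (cA ord0) cB dB (dAB ord0) (tAB ord0).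
pose a1 : 'I_3 := inord 1; pose a2 : 'I_3 := inord 2.
have n01 : ord0 != a1 by rewrite -val_eqE /= inordK.
have n02 : ord0 != a2 by rewrite -val_eqE /= inordK.
have n12 : a1 != a2 by rewrite -val_eqE /= !inordK.
have dAB' k i : k != ord0 -> [disjoint A k & B' i].
  move=> k0; have [_ _ s] := sB' i; rewrite disjoint_sym.
  apply: disjointWl s _; apply: disjointsU; first by rewrite disjoint_sym.
  by apply: dA; rewrite eq_sym.
have tAB' k i : touch gadj (A k) (B' i).
  by have [_ s _] := sB' i; apply: touchS (tAB k i).
have uAk k : k != ord0 -> u \notin A k.
  move=> k0; have D : [disjoint A ord0 & A k] by apply: dA; rewrite eq_sym.
  by have /pred0P/(_ u)/= := D; rewrite uA => /= ->.
have [v vA1] : exists v, v \in A a1 by have [v] := tAB a1 ord0; exists v.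
have [w wA2] : exists w, w \in A a2 by have [w] := tAB a2 ord0; exists w.
have : forall i, exists b, b \in B' i /\ gadj u b.
  by move=> i; have [_ /set1P-> [b bB ub]] := tB' i; exists b.
case/choice => b bP.
have : forall i, exists c, csupp c (B' i :|: A a1) /\
    forall x y, bd c x y = delta (b i) x y (+) delta v x y.
  move=> i; apply: chain_exists; rewrite ?inE ?vA1 ?orbT ?(proj1 (bP i)) //.
  by rewrite setUC; apply: conn_touchU => //; exact: gadj_sym.
case/choice => c cP.
pose p i := addc (echain u (b i)) (c i).
pose S i := [set u] :|: (B' i :|: A a1).
have p_supp i : csupp (p i) (S i).
  have [bB ub] := bP i; apply: csupp_addc; last first.
    by apply: csuppS (proj1 (cP i)); exact: subsetUr.
  apply: csuppS (echain_supp ub).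
  by apply/subsetP=> z; rewrite !inE => /orP[/eqP->|/eqP->]; rewrite ?eqxx ?bB ?orbT.
have p_bd i x y : bd (p i) x y = delta u x y (+) delta v x y.
  by rewrite bd_addc echain_bd ?(proj2 (bP i)) // (proj2 (cP i)) addbA addbK.
pose z i j := addc (p i) (p j).
have z_supp i j : csupp (z i j) (S i :|: S j).
  by apply: csupp_addc; [apply: csuppS (p_supp i)|apply: csuppS (p_supp j)];
     rewrite ?subsetUl ?subsetUr.
have z_bd i j x y : bd (z i j) x y = false by rewrite bd_addc !p_bd addbb.
have SD i k : i != k -> [disjoint S i & B' k :|: A a2].
  move=> ik; rewrite disjoint_sym.
  have uB' : u \notin B' k by have [] := sB' k.
  apply: disjointsU; rewrite disjoint_sym; apply: disjointsU.
  - by rewrite disjoints1.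
  - by apply: disjointsU; [exact: dB'|apply: dAB'; rewrite eq_sym].
  - by rewrite disjoints1 uAk // eq_sym.
  - apply: disjointsU; last exact: dA.
    by rewrite disjoint_sym; apply: dAB'; rewrite eq_sym.
have far i j k : i != k -> j != k ->
    face (z i j) (b k).1.+1 (b k).2.+1 = face (z i j) w.1.+1 w.2.+1.
  move=> ik jk; apply: (face_const (z_supp i j) (z_bd i j) (B := B' k :|: A a2)).
  - by rewrite setUC; apply: conn_touchU => //; exact: gadj_sym.
  - by apply: disjointsU; apply: SD.
  - by rewrite inE (proj1 (bP k)).
  - by rewrite inE wA2 orbT.
have near i j k : i != k -> j != k ->
    face (z i j) (b k).1.+1 (b k).2.+1 = face (z i j) u.1.+1 u.2.+1
     (+) ((b k).1 < u.1) && z i j false u.1.+1 u.2.+1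
     (+) ((b k).2 < u.2) && z i j true u.1.+1 u.2.+1.
  move=> ik jk; apply: (face_nbr (z_supp i j) (z_bd i j)); first by case: (bP k).
  apply: (csupp_avoids (z_supp i j)); have bk := proj1 (bP k).
  have H l : l != k -> b k \notin S l.
    by move=> lk; have /pred0P/(_ (b k))/= := SD l k lk; rewrite !inE bk andbT => ->.
  by rewrite inE negb_or !H.
(* [B' i] and [A a1] avoid [u], so the first edge of P_i is its only edge at [u]. *)
have pu i d : p i d u.1.+1 u.2.+1 = if d then u.1 < (b i).1 else u.2 < (b i).2.
  have [bB ub] := bP i; rewrite /p /addc.
  have -> : c i d u.1.+1 u.2.+1 = false.
    have uS : u \notin B' i :|: A a1.
      by rewrite inE negb_or uAk ?andbT 1?eq_sym //; have [] := sB' i.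
    by have [? _ ? _] := csupp_avoids (proj1 (cP i)) uS; case: d.
  rewrite addbF /echain; move: ub; rewrite /gadj.
  move: (nat_of_ord u.1) (nat_of_ord u.2) (nat_of_ord (b i).1) (nat_of_ord (b i).2).
  by move=> x y x' y'; case: d; rewrite eqSS eqxx; lia.
(* The two correction terms of [near] with [pu] substituted: the change of parity for P_i + P_j on
   the step from [u] to [b k]. *)
pose G i j k := ((b k).1 < u.1) && ((u.2 < (b i).2) (+) (u.2 < (b j).2))
  (+) ((b k).2 < u.2) && ((u.1 < (b i).1) (+) (u.1 < (b j).1)).
pose f i (x : P) := face (p i) x.1.+1 x.2.+1.
have fG i j k : i != k -> j != k -> f i w (+) f j w = f i u (+) f j u (+) G i j k.
  move=> ik jk; have := far i j k ik jk; rewrite (near i j k ik jk).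
  have zu d : z i j d u.1.+1 u.2.+1 = p i d u.1.+1 u.2.+1 (+) p j d u.1.+1 u.2.+1 by [].
  rewrite !zu !pu (face_addc (p i) (p j) u.1.+1) (face_addc (p i) (p j) w.1.+1).
  by rewrite -addbA => <-.
have Gsum : G ord0 a1 a2 (+) G ord0 a2 a1 (+) G a1 a2 ord0 = false.
  have := fG ord0 a1 a2 n02 n12; have := fG ord0 a2 a1 n01.
  have := fG a1 a2 ord0; rewrite ![_ == ord0]eq_sym n01 n02 [a2 == a1]eq_sym n12.
  move=> /(_ isT isT) + /(_ isT); move: (G _ _ _) (G _ _ _) (G _ _ _).
  move: (f ord0 w) (f a1 w) (f a2 w) (f ord0 u) (f a1 u) (f a2 u).
  by do 6!case; move=> [] [] [].
have b_neq i j : i != j -> ((b i).1 != (b j).1 :> nat) || ((b i).2 != (b j).2 :> nat).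
  move=> ij; rewrite -negb_and; apply/negP=> /andP[/eqP e1 /eqP e2].
  have /pred0P/(_ (b i))/= := dB' i j ij; rewrite (proj1 (bP i)).
  by rewrite (eqP_nat e1 e2) (proj1 (bP j)).
have := proj2 (bP ord0); have := proj2 (bP a1); have := proj2 (bP a2).
have := b_neq _ _ n01; have := b_neq _ _ n02; have := b_neq _ _ n12.
move: Gsum; rewrite /G /gadj; clear.
move: (nat_of_ord u.1) (nat_of_ord u.2) => x y.
move: (nat_of_ord (b ord0).1) (nat_of_ord (b ord0).2) => x0 y0.
move: (nat_of_ord (b a1).1) (nat_of_ord (b a1).2) => x1 y1.
move: (nat_of_ord (b a2).1) (nat_of_ord (b a2).2) => x2 y2.
(* Only [u] and three distinct neighbours of it are left; all 64 combinations of directions are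
   checked. *)
move=> H n1 n2 n3 /orP[]/andP[/eqP e /orP[]/eqP e'] /orP[]/andP[/eqP g /orP[]/eqP g']
  /orP[]/andP[/eqP h /orP[]/eqP h']; subst; try lia.
Qed.

End Grid.

Section GridHost.
Variable N : nat.
Local Notation P := ('I_N * 'I_N)%type.

Lemma gadj_deg (h : P) : #|[set h' | gadj h h']| <= 4.
Proof.
pose f (p : P) : nat * nat := (p.1 : nat, p.2 : nat).
have f_inj : injective f.
  by move=> [a b] [c d] [/val_inj-> /val_inj->].
rewrite cardE -(size_map f).
pose s := [:: (h.1.+1, h.2 : nat); (h.1.-1, h.2 : nat); (h.1 : nat, h.2.+1); (h.1 : nat, h.2.-1)].
apply: (@uniq_leq_size _ _ s); first by rewrite map_inj_uniq // enum_uniq.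
move=> x /mapP[p]; rewrite mem_enum inE /gadj => + ->; rewrite /f !inE !xpair_eqE.
move: (nat_of_ord h.1) (nat_of_ord h.2) (nat_of_ord p.1) (nat_of_ord p.2); lia.
Qed.

Lemma grid_conn : conn (@gadj N) setT.
Proof.
move=> B _ /set0Pn[p pB] cl.
pose S i j := exists r : P, [/\ r \in B, r.1 = i :> nat & r.2 = j :> nat].
have step i j i' j' : S i j -> i' < N -> j' < N ->
    (j == j') && ((i.+1 == i') || (i'.+1 == i)) ||
    (i == i') && ((j.+1 == j') || (j'.+1 == j)) -> S i' j'.
  move=> [r [rB <- <-]] li lj ij; exists (Ordinal li, Ordinal lj); split=> //.
  by apply: (cl r) => //; rewrite inE.
have right i j k : S i j -> j < N -> i + k < N -> S (i + k) j.
  move=> Sij lj; elim: k => [|k IH] lk; first by rewrite addn0.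
  by apply: (step (i + k) j) => //; [apply: IH; lia|rewrite eqxx addnS eqxx].
have left i j k : S i j -> j < N -> i < N -> S (i - k) j.
  move=> Sij lj li; elim: k => [|k IH]; first by rewrite subn0.
  have [le|lt] := leqP i k; first by rewrite (_ : i - k.+1 = i - k) //; lia.
  by apply: (step (i - k) j) => //; lia.
have up i j k : S i j -> i < N -> j + k < N -> S i (j + k).
  move=> Sij lj; elim: k => [|k IH] lk; first by rewrite addn0.
  by apply: (step i (j + k)) => //; [apply: IH; lia|rewrite eqxx addnS eqxx orbT].
have down i j k : S i j -> j < N -> i < N -> S i (j - k).
  move=> Sij lj li; elim: k => [|k IH]; first by rewrite subn0.
  have [le|lt] := leqP j k; first by rewrite (_ : j - k.+1 = j - k) //; lia.
  by apply: (step i (j - k)) => //; lia.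
apply/subsetP=> r _.
have S0 : S p.1 p.2 by exists p.
have S1 : S r.1 p.2.
  have [le|lt] := leqP p.1 r.1; first by rewrite -(subnKC le); apply: right; rewrite ?subnKC.
  by rewrite -(subKn (ltnW lt)); apply: left.
have [t [tB e1 e2]] : S r.1 r.2.
  have [le|lt] := leqP p.2 r.2; first by rewrite -(subnKC le); apply: up; rewrite ?subnKC.
  by rewrite -(subKn (ltnW lt)); apply: down.
by rewrite -(eqP_nat e1 e2).
Qed.

End GridHost.

(** The separator arguments use only this discrete model; nonempty strings ensure that every vertex
    is visible in the grid. *)
Definition grid_strings (V : finType) (adj : rel V) : Prop :=
  exists N (R : V -> {set 'I_N * 'I_N}),
    [/\ forall u v, adj u v = (u != v) && ~~ [disjoint R u & R v],
        forall v, conn (@gadj N) (R v) & forall v, R v != set0].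

(** * Existence of a halving separator *)

Section Light.
Variables (V : finType) (adj : rel V).
Hypothesis adj_sym : symmetric adj.

Definition nbr v : {set V} := [set u | adj v u].
Definition deg v : nat := #|nbr v|.

(* Breadth-first search from [A] in [J], where passing through [v] costs
   [deg v]: one of the first [W] levels is small. *)
Lemma light_or_cut (J A : {set V}) (W : nat) : 0 < W ->
  exists Z : {set V}, #|Z| * W <= \sum_v deg v /\
    forall J' : {set V}, conn adj J' -> J' \subset J -> [disjoint J' & Z] ->
      [disjoint J' & A] \/
      forall v, v \in J' -> exists P : {set V},
        [/\ conn adj P, P \subset J, v \in P, ~~ [disjoint P & A]
          & \sum_(u in P) deg u <= W].
Proof.
move=> W0.
pose lt t v := `[< exists P : {set V}, [/\ conn adj P, P \subset J, v \in P,
   ~~ [disjoint P & A] & \sum_(u in P) deg u <= t] >].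
have lt_mono s t v : s <= t -> lt s v -> lt t v.
  move=> st /asboolP[P [? ? ? ? le]]; apply/asboolP; exists P; split=> //.
  exact: leq_trans st.
pose Z t := [set v in J | ~~ lt t v && ((v \in A) || [exists u, adj u v && lt t u])].
have Zlt t v : v \in Z t -> ~~ lt t v /\ lt (t + deg v) v.
  rewrite inE => /and3P[vJ nlt H]; split=> //.
  have [lv|] := boolP (lt (t + deg v) v) => //; move/negP; case.
  case/orP: H => [vA|/existsP[u /andP[uv /asboolP[P [cP PJ uP PA le]]]]].
    apply/asboolP; exists [set v]; split; rewrite ?sub1set ?inE //; first exact: conn1.
      by rewrite disjoints1 negbK.
    by rewrite big_set1 leq_addl.
  apply/asboolP; exists (P :|: [set v]); split.
  - by apply: connUe uv => //; [exact: conn1|rewrite inE].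
  - by rewrite subUset PJ sub1set.
  - by rewrite !inE eqxx orbT.
  - by apply: contra PA; apply: disjointWl; apply: subsetUl.
  have [vP|vP] := boolP (v \in P).
    by rewrite (setUidPl _) ?sub1set // (leq_trans le) ?leq_addr.
  by rewrite setUC big_setU1 //= addnC leq_add2r.
(* Each [v] lies on at most [deg v] levels: if [t1] is its first level, it is reached within budget
   [t1 + deg v] and is absent from then on. *)
have Zsum : \sum_(t < W) #|Z t| <= \sum_v deg v.
  have -> : \sum_(t < W) #|Z t| = \sum_(t < W) \sum_v (if v \in Z t then 1 else 0).
    by apply: eq_bigr => t _; rewrite -sum1dep_card big_mkcond; apply: eq_bigr => v _; rewrite !inE.
  rewrite exchange_big /=; apply: leq_sum => v _.
  have [[t0 t0Z]|noZ] := pselect (exists t, v \in Z t); last first.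
    rewrite big1 // => t _; case: ifP => // vZ; case: noZ; by exists t.
  have [t1 t1Z mint1] := ex_minnP (ex_intro (fun t => v \in Z t) t0 t0Z).
  rewrite -big_mkcond /= sum1_card.
  have inj (t : 'I_W) : v \in Z t -> t1 <= t < t1 + deg v.
    move=> vt; rewrite mint1 //=; rewrite ltnNge; apply/negP=> le.
    have [_ l1] := Zlt _ _ t1Z; have [/negP] := Zlt _ _ vt; case.
    exact: lt_mono le l1.
  rewrite cardE -(size_map val) -[X in _ <= X](size_iota t1).
  apply: uniq_leq_size => [|k /mapP[t]].
    by rewrite map_inj_uniq ?enum_uniq //; exact: val_inj.
  by rewrite mem_enum => vt ->; rewrite mem_iota; exact: inj.
have [[t tW]|no] := pselect (exists t : 'I_W, #|Z t| * W <= \sum_v deg v).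
  exists (Z t); split=> // J' cJ' J'J dZ.
  have [dl|/not_disjoint[x xJ' ltx]] := pselect [disjoint J' & [set v | lt t v]].
    left; apply: disjoint_intro => x xJ' xA.
    have := mem_disjointF dZ xJ'; rewrite inE (subsetP J'J) // xA /= andbT negbK => ltx.
    by have := mem_disjointF dl xJ'; rewrite inE ltx.
  right; have /subsetP all : J' \subset J' :&: [set v | lt t v].
    apply: cJ'; first exact: subsetIl.
      by apply/set0Pn; exists x; rewrite inE xJ' ltx.
    move=> a b /setIP[aJ' lta] bJ' ab; rewrite !inE bJ' /=.
    have := mem_disjointF dZ bJ'; rewrite inE (subsetP J'J) //= negb_and negbK.
    case/orP=> //; case/norP=> _ /existsP[]; exists a; rewrite ab.
    by move: lta; rewrite inE.
  move=> v /all /setIP[_]; rewrite inE => /asboolP[P [? ? ? ? le]].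
  by exists P; split=> //; apply: leq_trans le _; apply: ltnW.
exfalso; have : W * (\sum_v deg v).+1 <= \sum_(t < W) #|Z t| * W.
  rewrite -[X in X * _]card_ord -sum_nat_const; apply: leq_sum => t _.
  by rewrite ltnNge; apply/negP=> le; apply: no; exists t.
by rewrite -big_distrl /= mulnC leq_pmul2r // ltnNge Zsum.
Qed.

Definition nbrs (F : {set V}) : {set V} := \bigcup_(v in F) nbr v.

Lemma card_nbrs F : #|nbrs F| <= \sum_(v in F) deg v.
Proof. exact: card_bigcup_le. Qed.

End Light.

(** * Large parts, their regions and the cost of cutting off grid points *)

Section Core.
Variables (V H : finType) (adj : rel V) (hadj : rel H) (R : V -> {set H}).
Variable q : nat.
Hypothesis adjE : forall u v, adj u v = (u != v) && ~~ [disjoint R u & R v].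
Hypothesis hadj_sym : symmetric hadj.
Hypothesis hadj_deg : forall h, #|[set h' | hadj h h']| <= 4.
Hypothesis host_conn : conn hadj setT.
Hypothesis R_conn : forall v, conn hadj (R v).
Hypothesis R_neq0 : forall v, R v != set0.
Hypothesis K33_free : forall A B : 'I_3 -> {set H},
  (forall i, conn hadj (A i)) -> (forall i, conn hadj (B i)) ->
  (forall i j, i != j -> [disjoint A i & A j]) ->
  (forall i j, i != j -> [disjoint B i & B j]) ->
  (forall i j, [disjoint A i & B j]) ->
  (forall i j, touch hadj (A i) (B j)) -> False.
Hypothesis q_gt0 : 0 < q.
Hypothesis deg_sum : \sum_v deg adj v <= 2 * q ^ 2.
Variable big : {set V} -> bool.
Hypothesis big_mono : forall A B : {set V}, A \subset B -> big A -> big B.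
Hypothesis big_meet : forall A B : {set V}, big A -> big B -> A :&: B != set0.
(* Where 430 comes from: finding three light parts needs 23q = 2q (heavy vertices) + 2 * 9q
   (neighbourhoods of the first two) + 3q (level cuts); splitting off two of
   the three pieces of [U] costs 4 * 23q + 2q each, so [U] must be out of reach for
   212q >= 2 * 94q + 23q strings; and 212q + 214q <= 430q. *)
Hypothesis haven : forall Z : {set V}, #|Z| <= 430 * q ->
  exists A, [/\ conn adj A, big A & [disjoint A & Z]].

Lemma meet_sym : symmetric adj.
Proof. by move=> u v; rewrite !adjE eq_sym disjoint_sym. Qed.

Definition region (A : {set V}) : {set H} := \bigcup_(v in A) R v.

(** A part of the region closed under [hadj] contains every string that it meets, and adjacent
    vertices have strings with a common point. *)
Lemma region_conn (A : {set V}) : conn adj A -> conn hadj (region A).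
Proof.
move=> cA C sC /set0Pn[c cC] clC.
have RC v : v \in A -> ~~ [disjoint R v & C] -> R v \subset C.
  move=> vA; rewrite -setI_eq0 => meet; apply: subset_trans (subsetIr (R v) C).
  apply: R_conn; rewrite ?subsetIl // => x y /setIP[xR xC] yR xy.
  by rewrite inE yR (clC x) //; apply/bigcupP; exists v.
have /bigcupP[v vA cv] := subsetP sC c cC.
pose B := [set v in A | R v \subset C].
have /subsetP AB : A \subset B.
  apply: cA; first by apply/subsetP=> w; rewrite inE => /andP[].
    apply/set0Pn; exists v; rewrite inE vA RC //.
    by apply/negP=> /mem_disjointF/(_ cv); rewrite cC.
  move=> a b; rewrite inE => /andP[aA /subsetP aC] bA; rewrite adjE => /andP[_ /negP].
  move=> /not_disjoint[x xa xb]; rewrite inE bA RC //.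
  by apply/negP=> /mem_disjointF/(_ xb); rewrite (aC _ xa).
by apply/bigcupsP=> w /AB; rewrite inE => /andP[].
Qed.

Lemma regionS (A B : {set V}) : A \subset B -> region A \subset region B.
Proof.
by move=> /subsetP AB; apply/bigcupsP=> v vA; apply: bigcup_sup; apply: AB.
Qed.

Definition at_point h : {set V} := [set v | h \in R v].

(** The strings through [h] are pairwise adjacent, so $k$ of them contribute at least $k(k-1)$ to
    the degree sum. *)
Lemma card_at_point h : #|at_point h| <= 2 * q.
Proof.
have : #|at_point h| * #|at_point h|.-1 <= 2 * q ^ 2.
  apply: leq_trans deg_sum; rewrite (bigID (mem (at_point h))) /=.
  apply: leq_trans (leq_addr _ _); rewrite -sum_nat_const; apply: leq_sum => v vh.
  have -> : #|at_point h|.-1 = #|at_point h :\ v| by rewrite (cardsD1 v) vh.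
  apply: subset_leq_card; apply/subsetP=> u; rewrite !inE adjE => /andP[uv hu].
  rewrite eq_sym uv /=; apply/negP=> d; move: vh; rewrite inE => vh.
  by have := mem_disjointF d vh; rewrite hu.
rewrite expnS expn1; move: q_gt0; case: #|_| => [|n] //=; nia.
Qed.

(** Deleted beforehand, so that each landing string added to a link brings at most [q]
    neighbours. *)
Definition heavy : {set V} := [set v | q < deg adj v].

Lemma card_heavy : #|heavy| <= 2 * q.
Proof.
have : #|heavy| * q.+1 <= 2 * q ^ 2.
  apply: leq_trans deg_sum; rewrite (bigID (mem heavy)) /=.
  apply: leq_trans (leq_addr _ _); rewrite -sum_nat_const; apply: leq_sum => v.
  by rewrite inE.
by rewrite expnS expn1; nia.
Qed.

(** Big sets meet pairwise, so this union is a single connected set; it is empty if there is no such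
    [A]. *)
Definition beta (Z : {set V}) : {set V} :=
  \bigcup_(A | `[< [/\ conn adj A, big A & [disjoint A & Z]] >]) A.

Lemma beta_disjoint (Z : {set V}) : [disjoint beta Z & Z].
Proof.
apply: disjoint_intro => x /bigcupP[A /asboolP[_ _ dA] xA].
by have := mem_disjointF dA xA => /negP.
Qed.

Lemma beta_conn Z : conn adj (beta Z).
Proof.
have [[A PA]|no] := pselect (exists A, [/\ conn adj A, big A & [disjoint A & Z]]).
  apply: (@conn_bigcup _ _ _ A) => [B /asboolP[]//||B /asboolP[_ bB _]].
    exact/asboolP.
  by apply: big_meet => //; case: PA.
rewrite /beta big1 => [|A /asboolP PA]; first exact: conn0.
by case: no; exists A.
Qed.

Lemma beta_big (Z : {set V}) : #|Z| <= 430 * q -> big (beta Z).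
Proof.
move=> /haven[A PA]; apply: (@big_mono A); last by case: PA.
by apply: bigcup_sup; apply/asboolP.
Qed.

Lemma beta_neq0 (Z : {set V}) : #|Z| <= 430 * q -> exists v, v \in beta Z.
Proof. by move=> /beta_big b; have /set0Pn[x /setIP[xb _]] := big_meet b b; exists x. Qed.

Lemma betaS (Z Z' : {set V}) : Z \subset Z' -> beta Z' \subset beta Z.
Proof.
move=> sZ; apply/bigcupsP=> A /asboolP[cA bA dA]; apply: bigcup_sup; apply/asboolP.
by split=> //; apply: disjointWr dA.
Qed.

Lemma beta_absorb (Z : {set V}) v x : v \in beta Z -> x \notin Z -> adj v x -> x \in beta Z.
Proof.
move=> /bigcupP[A /asboolP[cA bA dA] vA] xZ vx.
apply/bigcupP; exists (A :|: [set x]); last by rewrite !inE eqxx orbT.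
apply/asboolP; split.
- by apply: connUe vx => //; [exact: meet_sym|exact: conn1|rewrite inE].
- by apply: big_mono bA; apply: subsetUl.
- by apply: disjointsU => //; rewrite disjoints1.
Qed.

Definition cut k (U : {set H}) : Prop :=
  exists Z : {set V}, #|Z| <= k /\ [disjoint region (beta Z) & U].

(** Costs add because [beta] shrinks as the deleted set grows. *)
Lemma cutU k l U U' : cut k U -> cut l U' -> cut (k + l) (U :|: U').
Proof.
move=> [Z [leZ dZ]] [Z' [leZ' dZ']]; exists (Z :|: Z'); split.
  by apply: leq_trans (leq_card_setU _ _) _; apply: leq_add.
rewrite disjoint_sym; apply: disjointsU; rewrite disjoint_sym.
  by apply: disjointWl dZ; apply: regionS; apply: betaS; apply: subsetUl.
by apply: disjointWl dZ'; apply: regionS; apply: betaS; apply: subsetUr.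
Qed.

Lemma cut1 h : cut (2 * q) [set h].
Proof.
exists (at_point h); split; first exact: card_at_point.
rewrite disjoint_sym disjoints1; apply/negP=> /bigcupP[v vb hv].
by have := mem_disjointF (beta_disjoint _) vb; rewrite inE hv.
Qed.

(* [U] is chosen maximal among the connected host sets that [214 * q] strings cut
   off; adding one point costs at most [2 * q] strings, whence the lower bound. *)
Lemma core_frame : exists (U : {set H}) (Z0 : {set V}),
  [/\ conn hadj U /\ 212 * q < #|Z0| <= 214 * q,
      [disjoint region (beta Z0) & U],
      forall h h', h \in U -> hadj h h' -> h' \notin U -> h' \in region (beta Z0)
    & forall Z : {set V}, #|Z| < #|Z0| -> ~ [disjoint region (beta Z) & U] ].
Proof.
pose P (U : {set H}) := `[< conn hadj U /\ cut (214 * q) U >].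
have P0 : P set0.
  apply/asboolP; split; first exact: conn0.
  by exists set0; rewrite cards0 -setI_eq0 setI0.
have [U /maxsetP[/asboolP[cU kU] maxU] _] := maxset_exists P0.
have nkU (Z : {set V}) : #|Z| <= 212 * q -> ~ [disjoint region (beta Z) & U].
  move=> leZ dZ.
  have [h hU hconn] : exists2 h, h \notin U & conn hadj (U :|: [set h]).
    have [v vb] : exists v, v \in beta Z by apply: beta_neq0; lia.
    have /set0Pn[p pv] := R_neq0 v.
    have pU : p \notin U.
      by apply: (mem_disjointF dZ); apply/bigcupP; exists v.
    have [->|/set0Pn[u uU]] := eqVneq U set0.
      by exists p; rewrite ?set0U ?inE //; exact: conn1.
    have [a [b [aU _ bU ab]]] := conn_cross host_conn (subsetT U) uU (in_setT p) pU.
    by exists b => //; apply: connUe ab => //; [exact: conn1|rewrite inE].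
  have cutUh : cut (212 * q + 2 * q) (U :|: [set h]) by apply: cutU; [exists Z|exact: cut1].
  have E : U :|: [set h] = U.
    apply: maxU; last exact: subsetUl.
    by apply/asboolP; split=> //; rewrite -mulnDl in cutUh.
  by move: hU; rewrite -E !inE eqxx orbT.
have kex : exists k, `[< cut k U >] by exists (214 * q); apply/asboolP.
case: (ex_minnP kex) => k /asboolP[Z0 [leZ0 dZ0]] mink.
have Z0k : #|Z0| = k.
  by apply/eqP; rewrite eqn_leq leZ0 mink //; apply/asboolP; exists Z0.
exists U, Z0; split=> //.
- split=> //; rewrite Z0k; apply/andP; split; last by apply: mink; apply/asboolP.
  by rewrite ltnNge; apply/negP=> le; apply: (nkU Z0); rewrite ?Z0k.
(* A neighbour of [U] on no string of [beta Z0] could join [U] at no extra cost. *)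
- move=> h h' hU hh' h'U; apply: contrapT => /negP h'R.
  have E : U :|: [set h'] = U.
    apply: maxU; last exact: subsetUl.
    apply/asboolP; split; first by apply: connUe hh' => //; [exact: conn1|rewrite inE].
    exists Z0; rewrite Z0k; split; first by apply: mink; apply/asboolP.
    by rewrite disjoint_sym; apply: disjointsU; [rewrite disjoint_sym|rewrite disjoints1].
  by move: h'U; rewrite -E !inE eqxx orbT.
- move=> Z ltZ dZ; move: ltZ; rewrite Z0k ltnNge mink //.
  by apply/asboolP; exists Z.
Qed.

(** * Landings on [U], the three pieces and the three links *)

Section Landing.
Variables (U : {set H}) (Z0 : {set V}).
Hypothesis U_conn : conn hadj U.
Hypothesis Z0_gt : 212 * q < #|Z0|.
Hypothesis Z0_le : #|Z0| <= 214 * q.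
Hypothesis Z0_cut : [disjoint region (beta Z0) & U].
Hypothesis U_out : forall h h', h \in U -> hadj h h' -> h' \notin U ->
  h' \in region (beta Z0).
Hypothesis Z0_min : forall Z : {set V}, #|Z| < #|Z0| -> ~ [disjoint region (beta Z) & U].

Lemma beta_avoids v : v \in beta Z0 -> [disjoint R v & U].
Proof. by move=> vb; apply: disjointWl Z0_cut; apply: bigcup_sup vb. Qed.

(** Otherwise the strings of [Z0] that meet [U] form a smaller set [Z1], and [beta Z1] reaches [U].
    Follow it from [beta Z0] to a first string [b] that meets [U]: [b] is not in [Z0] and meets no
    string of [beta Z0], so by [U_out] it lies inside [U]; yet its predecessor [a] meets [b] and
    misses [U]. *)
Lemma Z0_meets x : x \in Z0 -> ~~ [disjoint R x & U].
Proof.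
pose Z1 := [set x in Z0 | ~~ [disjoint R x & U]].
have Z10 : Z1 \subset Z0 by apply/subsetP=> y; rewrite inE => /andP[].
suff : Z1 = Z0 by move=> <-; rewrite inE => /andP[].
apply/eqP; rewrite eqEcard Z10 /= leqNgt; apply/negP=> lt1.
have /not_disjoint[h /bigcupP[y yb hy] hU] := Z0_min lt1.
have b01 : beta Z0 \subset beta Z1 by apply: betaS.
have [v vb] : exists v, v \in beta Z0 by apply: beta_neq0; lia.
pose B := [set v in beta Z1 | [disjoint R v & U]].
have vB : v \in B by rewrite inE (subsetP b01) //= beta_avoids.
pose C := component adj B v.
have yC : y \notin C.
  apply/negP=> /(subsetP (component_sub _ _ _)); rewrite inE => /andP[_ d].
  by have := mem_disjointF d hy; rewrite hU.
have sC : C \subset beta Z1.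
  by apply: subset_trans (component_sub _ _ _) _; apply/subsetP=> w; rewrite inE => /andP[].
have [a [b [aC bb bC ab]]] := conn_cross (@beta_conn Z1) sC (mem_component adj vB) yb yC.
have aU : [disjoint R a & U].
  by have /(subsetP (component_sub _ _ _)) := aC; rewrite inE => /andP[].
have bU : ~ [disjoint R b & U].
  move=> d; case/negP: bC; apply: component_adj aC _ ab; first exact: meet_sym.
  by rewrite inE bb.
have bZ0 : b \notin Z0.
  apply/negP=> bZ0; have := mem_disjointF (beta_disjoint Z1) bb.
  by rewrite inE bZ0 negbK => /bU.
have bR : [disjoint R b & region (beta Z0)].
  apply: disjoint_intro => p pb /bigcupP[w wb pw]; apply: bU; apply: beta_avoids.
  have [<-//|bw] := eqVneq w b.
  apply: beta_absorb wb bZ0 _; rewrite adjE bw /=.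
  by apply/negP=> d; have := mem_disjointF d pw; rewrite pb.
have [u ub uU] := not_disjoint bU.
have sub : R b \subset U.
  suff : R b \subset R b :&: U by move=> s'; apply: subset_trans s' (subsetIr _ _).
  apply: R_conn; rewrite ?subsetIl //; first by apply/set0Pn; exists u; rewrite inE ub.
  move=> p p' /setIP[pb pU] p'b pp'; rewrite inE p'b /=.
  apply: contrapT => /negP p'U; have := U_out pU pp' p'U.
  by move/negP: (mem_disjointF bR p'b).
move: ab; rewrite adjE => /andP[_ /negP]; apply; exact: disjointWr sub aU.
Qed.

(** String [x] arrives at [h] from outside [U], and [Q] is the portion that joins the large part to
    [h]. Deleting [Z0] along with [Z] keeps the large part off [U]. *)
Definition land (Z : {set V}) x h : Prop :=
  h \in R x /\ exists Q : {set H},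
    [/\ conn hadj Q, Q \subset R x, [disjoint Q & U],
        ~~ [disjoint Q & region (beta (Z :|: Z0))] & exists2 p, p \in Q & hadj p h].

Lemma landS (Z Z' : {set V}) x h : Z \subset Z' -> land Z' x h -> land Z x h.
Proof.
move=> sZ [hx [Q [cQ sQ dQ mQ pQ]]]; split=> //; exists Q; split=> //.
apply: contra mQ; apply: disjointWr; apply: regionS; apply: betaS; exact: setSU.
Qed.

Definition cutI k (I : {set H}) : Prop :=
  exists Z : {set V}, #|Z| <= k /\
    forall x h, x \notin Z -> h \in I -> ~ land Z x h.

(** With fewer than [#|Z0|] strings deleted, [beta Z] still reaches [U]. A first string [x] of it
    outside [beta (Z :|: Z0)] must belong to [Z0], hence meets [U], and it lands where it enters
    [U]. *)
Lemma not_cutI_U : ~ cutI (212 * q) U.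
Proof.
move=> [Z [leZ noland]].
have ltZ : #|Z| < #|Z0| by apply: leq_ltn_trans leZ Z0_gt.
have /not_disjoint[h /bigcupP[y yb hy] hU] := Z0_min ltZ.
set J := beta (Z :|: Z0).
have J0 : J \subset beta Z0 by apply: betaS; apply: subsetUr.
have JZ : J \subset beta Z by apply: betaS; apply: subsetUl.
have [v vJ] : exists v, v \in J.
  by apply: beta_neq0; apply: leq_trans (leq_card_setU _ _) _; lia.
have yJ : y \notin J.
  apply/negP=> /(subsetP J0) /beta_avoids d.
  by have := mem_disjointF d hy; rewrite hU.
have [c [x [cJ xb xJ cx]]] := conn_cross (@beta_conn Z) JZ vJ yb yJ.
have xZ : x \notin Z := mem_disjointF (beta_disjoint Z) xb.
have xZ0 : x \in Z0.
  apply: contrapT => /negP xZ0; case/negP: xJ; apply: beta_absorb cJ _ cx.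
  by rewrite inE negb_or xZ.
have /negP/not_disjoint[u ux uU] := Z0_meets xZ0.
have [p pc px] : exists2 p, p \in R c & p \in R x.
  by move: cx; rewrite adjE => /andP[_ /negP/not_disjoint].
have pU : p \notin U := mem_disjointF (beta_avoids (subsetP J0 _ cJ)) pc.
have pA : p \in R x :\: U by rewrite inE pU.
pose Q := component hadj (R x :\: U) p.
have sQ : Q \subset R x by apply: subset_trans (component_sub _ _ _) (subsetDl _ _).
have dQ : [disjoint Q & U].
  by apply: disjointWl (component_sub _ _ _) _; rewrite -setI_eq0 setIDAC setDIl setDv setI0.
have uQ : u \notin Q by apply/negP=> /(mem_disjointF dQ); rewrite uU.
have [a [b [aQ bx bQ ab]]] := conn_cross (@R_conn x) sQ (mem_component _ pA) ux uQ.
have bU : b \in U.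
  apply: contrapT => /negP bU; case/negP: bQ; apply: component_adj aQ _ ab => //.
  by rewrite inE bU.
apply: (noland x b xZ bU); split=> //; exists Q; split=> //; first exact: component_conn.
  apply/negP=> d; have := mem_disjointF d (mem_component hadj pA).
  by case/negP; apply/bigcupP; exists c.
by exists a.
Qed.

Lemma cutIS k l (I I' : {set H}) : k <= l -> I' \subset I -> cutI k I -> cutI l I'.
Proof.
move=> kl /subsetP sI [Z [leZ H1]]; exists Z; split; first exact: leq_trans kl.
by move=> x h xZ /sI; apply: H1.
Qed.

Lemma cutIU k l (I I' : {set H}) : cutI k I -> cutI l I' -> cutI (k + l) (I :|: I').
Proof.
move=> [Z [leZ H1]] [Z' [leZ' H2]]; exists (Z :|: Z'); split.
  by apply: leq_trans (leq_card_setU _ _) _; apply: leq_add.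
move=> x h; rewrite inE negb_or => /andP[xZ xZ'] /setUP[hI|hI] lnd.
  by apply: (H1 x h xZ hI); apply: landS lnd; apply: subsetUl.
by apply: (H2 x h xZ' hI); apply: landS lnd; apply: subsetUr.
Qed.

Lemma cutI1 h : cutI (2 * q) [set h].
Proof.
exists (at_point h); split; first exact: card_at_point.
by move=> x h' + /set1P-> [hx _]; rewrite inE hx.
Qed.

Lemma cutI0 k : cutI k set0.
Proof. by exists set0; rewrite cards0; split=> // x h _; rewrite inE. Qed.

Lemma cutI_bigcup z (D : H -> {set H}) (s : seq H) :
  (forall y, y \in s -> cutI z (D y)) -> cutI (size s * z) (\bigcup_(y <- s) D y).
Proof.
elim: s => [|y s IH] cD; first by rewrite big_nil; exact: cutI0.
rewrite big_cons mulSn; apply: cutIU; first by apply: cD; rewrite inE eqxx.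
by apply: IH => w ws; apply: cD; rewrite inE ws orbT.
Qed.

(* A minimal connected part [W] that is hard to cut, with connected complement:
   removing a vertex from [W] leaves at most 4 components, each easy to cut. *)
Lemma split_off z (S : {set H}) : conn hadj S -> ~ cutI z S ->
  exists W : {set H}, [/\ conn hadj W, W \subset S, conn hadj (S :\: W), ~ cutI z W
    & cutI (4 * z + 2 * q) W].
Proof.
move=> cS nS.
pose P (W : {set H}) :=
  `[< [/\ conn hadj W, W \subset S, conn hadj (S :\: W) & ~ cutI z W] >].
have PS : P S by apply/asboolP; split=> //; rewrite setDv; exact: conn0.
have [W /minsetP[/asboolP[cW sW cSW nW] minW] _] := minset_exists PS.
exists W; split=> //.
have [h hW hadjSW] : exists2 h, h \in W & S :\: W = set0 \/
    exists2 b, b \in S :\: W & hadj h b.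
  have [E|/set0Pn[b bSW]] := eqVneq (S :\: W) set0; last first.
    have [W0|/set0Pn[w wW]] := eqVneq W set0.
      by case: nW; rewrite W0; exact: cutI0.
    have [bW bS] : b \notin W /\ b \in S by move: bSW; rewrite inE => /andP[].
    have [a [c [aW cS' cW' ac]]] := conn_cross cS sW wW bS bW.
    by exists a => //; right; exists c; rewrite // inE cW'.
  have [W0|/set0Pn[w wW]] := eqVneq W set0; last by exists w => //; left.
  by case: nW; rewrite W0; exact: cutI0.
pose D y := component hadj (W :\ h) y.
have DW y : D y \subset W.
  by apply: subset_trans (component_sub _ _ _) (subsetDl _ _).
have hD y : h \notin D y.
  by apply/negP=> /(subsetP (component_sub _ _ _)); rewrite !inE eqxx.
have D_adj y : y \in W :\ h -> exists2 a, a \in D y & hadj h a.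
  move=> yW; have [a [b [aD bW bD ab]]] := conn_cross cW (DW y) (mem_component _ yW) hW (hD y).
  exists a => //; have [<-|bh] := eqVneq b h; first by rewrite hadj_sym.
  by case/negP: bD; apply: component_adj aD _ ab; rewrite // !inE bh.
(* If [D y] were hard to cut, minimality would give [D y = W], although [h] is not in [D y]. The
   complement of [D y] in [S] is connected because [h] is adjacent to every component of [W :\ h]
   and, if it is nonempty, to [S :\: W]. *)
have cutD y : y \in W :\ h -> cutI z (D y).
  move=> yW; apply: contrapT => nD.
  have E : D y = W.
    apply: minW (DW y); apply/asboolP; split=> //; first exact: component_conn.
      exact: subset_trans (DW y) sW.
    have hSD : h \in S :\: D y by rewrite inE hD (subsetP sW).
    suff /eqP-> : S :\: D y == component hadj (S :\: D y) h by exact: component_conn.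
    rewrite eqEsubset component_sub andbT; apply/subsetP=> w; rewrite inE => /andP[wD wS].
    have [->|wh] := eqVneq w h; first exact: mem_component.
    have [wW|wW] := boolP (w \in W).
      have wW' : w \in W :\ h by rewrite !inE wh.
      have sub : [set h] :|: D w \subset S :\: D y.
        rewrite subUset sub1set hSD /= subsetD (subset_trans (DW w) sW) /=.
        apply: disjoint_intro => a aw ay; case/negP: wD.
        suff /subsetP : D w \subset D y by apply; exact: mem_component.
        apply: component_meet => //; rewrite ?component_sub //; first exact: component_conn.
        by apply/set0Pn; exists a; rewrite inE aw.
      have [a aD ha] := D_adj w wW'.
      have /subsetP : [set h] :|: D w \subset component hadj (S :\: D y) h.
        apply: sub_component => //; last by rewrite !inE eqxx.
        by apply: connUe ha => //; [exact: conn1|exact: component_conn|rewrite inE].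
      by apply; rewrite inE mem_component ?orbT.
    have wSW : w \in S :\: W by rewrite inE wW.
    case: hadjSW => [E|[b bSW hb]]; first by rewrite E inE in wSW.
    have /subsetP : [set h] :|: (S :\: W) \subset component hadj (S :\: D y) h.
      apply: sub_component => //; [|by rewrite !inE eqxx|].
        by apply: connUe hb => //; [exact: conn1|rewrite inE].
      by rewrite subUset sub1set hSD /= setDS.
    by apply; rewrite inE wSW orbT.
  by move: (hD y); rewrite E hW.
pose N := [set y | hadj h y] :&: (W :\ h).
have leN : size (enum N) <= 4.
  rewrite -cardE; apply: leq_trans (hadj_deg h).
  by apply: subset_leq_card; exact: subsetIl.
have cN : cutI (size (enum N) * z) (\bigcup_(y <- enum N) D y).
  by apply: cutI_bigcup => y; rewrite mem_enum => /setIP[_ /cutD].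
apply: cutIS (cutIU cN (cutI1 h)); first by rewrite leq_add2r leq_mul2r leN orbT.
apply/subsetP=> w wW; rewrite inE; have [->|wh] := eqVneq w h; first by rewrite inE eqxx orbT.
apply/orP; left; have wW' : w \in W :\ h by rewrite !inE wh.
have [a aD ha] := D_adj w wW'.
have aW : a \in W :\ h := subsetP (component_sub _ _ _) _ aD.
rewrite big_enum; apply/bigcupP; exists a; first by rewrite inE aW inE ha.
suff /subsetP : D w \subset D a by apply; exact: mem_component.
apply: component_meet => //; rewrite ?component_sub //; first exact: component_conn.
by apply/set0Pn; exists a; rewrite inE aD mem_component.
Qed.

(** Splitting off a piece costs [94 * q], so of [212 * q] there remain [118 * q] and then [24 * q],
    enough for a third piece at [23 * q]. *)
Lemma three_arcs : exists W : 'I_3 -> {set H},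
  [/\ forall i, conn hadj (W i), forall i, W i \subset U,
      forall i j, i != j -> [disjoint W i & W j]
    & forall i, ~ cutI (23 * q) (W i)].
Proof.
have [|W0 [c0 s0 cD0 n0 k0]] := @split_off (23 * q) U U_conn.
  by apply: contra_not not_cutI_U => k; apply: cutIS k; rewrite ?leq_mul2r ?orbT.
set U1 := U :\: W0 in cD0.
have nU1 : ~ cutI (118 * q) U1.
  apply: contra_not not_cutI_U => k; apply: cutIS (cutIU k0 k); first by lia.
  by apply/subsetP=> w wU; rewrite !inE wU andbT orbN.
have [|W1 [c1 s1 cD1 n1 k1]] := @split_off (23 * q) U1 cD0.
  by apply: contra_not nU1 => k; apply: cutIS k; rewrite ?leq_mul2r ?orbT.
set W2 := U1 :\: W1 in cD1.
have n2 : ~ cutI (23 * q) W2.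
  apply: contra_not nU1 => k; apply: cutIS (cutIU k1 k); first by lia.
  by apply/subsetP=> w wU; rewrite inE [w \in W2]inE wU andbT orbN.
have U1U : U1 \subset U by apply: subsetDl.
have d01 : [disjoint W0 & W1].
  by rewrite disjoint_sym; apply: disjointWl s1 _; rewrite -setI_eq0 setIDAC setDIl setDv setI0.
have d02 : [disjoint W0 & W2].
  rewrite disjoint_sym; apply: disjointWl (subsetDl _ _) _.
  by rewrite -setI_eq0 setIDAC setDIl setDv setI0.
have d12 : [disjoint W1 & W2].
  by rewrite disjoint_sym -setI_eq0 setIDAC setDIl setDv setI0.
exists (fun i : 'I_3 => nth set0 [:: W0; W1; W2] i); split.
- by case=> [[|[|[|]]] ?].
- case=> [[|[|[|//]]] ?] //=; first exact: subset_trans U1U.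
  exact: subset_trans (subsetDl _ _) U1U.
- by case=> [[|[|[|//]]] ?] [[|[|[|//]]] ?] //=; rewrite disjoint_sym.
- by case=> [[|[|[|]]] ?].
Qed.

(** [A i] consists of the vertices of [J] met by a string outside [Z] on its way to [W i]. If [Js]
    missed [A i], then [Zs] would stop all landings on [W i] at cost [23 * q]. So a vertex [v] of
    [Js] has light connections [P i] to all three [A i]; together with the landing strings [x i]
    they form [F], whose neighbourhood has at most $3(2q + q)$ vertices. *)
Lemma light_link (W : 'I_3 -> {set H}) (Z : {set V}) :
  (forall i, W i \subset U) -> (forall i, ~ cutI (23 * q) (W i)) ->
  heavy \subset Z -> #|Z| <= 20 * q ->
  exists (F : {set V}) (Q : {set H}),
    [/\ conn hadj Q, Q \subset region F, [disjoint Q & U], forall i, touch hadj Q (W i)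
      & [/\ [disjoint F & Z], #|nbrs adj F| <= 9 * q & F \subset nbrs adj F]].
Proof.
move=> WU nW hZ leZ.
pose J := beta (Z :|: Z0).
have J0 : J \subset beta Z0 by apply: betaS; apply: subsetUr.
have JZ : [disjoint J & Z] by apply: disjointWr (beta_disjoint (Z :|: Z0)); apply: subsetUl.
pose good i c x h (Q : {set H}) := [/\ x \notin Z, h \in W i & h \in R x] /\
  [/\ conn hadj Q, Q \subset R x, [disjoint Q & U], ~~ [disjoint Q & R c]
    & exists2 p, p \in Q & hadj p h].
pose A i := [set c in J | `[< exists x h Q, good i c x h Q >]].
have q2 : 0 < 2 * q by rewrite muln_gt0.
have [Zi ZiP] := choice (fun i => light_or_cut meet_sym J (A i) q2).
have leZi i : #|Zi i| <= q.
  have [le _] := ZiP i; rewrite -(leq_pmul2r q2); apply: leq_trans le _.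
  by apply: leq_trans deg_sum _; rewrite expnS expn1 mulnCA.
pose Zs := Z :|: \bigcup_(i : 'I_3) Zi i.
have leZs : #|Zs| <= 23 * q.
  apply: leq_trans (leq_card_setU _ _) _.
  have : #|\bigcup_(i : 'I_3) Zi i| <= 3 * q.
    have -> : 3 * q = \sum_(i : 'I_3) q by rewrite sum_nat_const card_ord.
    by apply: leq_trans (card_bigcup_le _ _) _; exact: leq_sum.
  by lia.
pose Js := beta (Zs :|: Z0).
have JsJ : Js \subset J by apply: betaS; apply: setSU; apply: subsetUl.
have [v vJs] : exists v, v \in Js.
  by apply: beta_neq0; apply: leq_trans (leq_card_setU _ _) _; lia.
have : forall i, exists P : {set V},
    [/\ conn adj P, P \subset J, v \in P, ~~ [disjoint P & A i]
      & \sum_(u in P) deg adj u <= 2 * q].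
  move=> i; have [_ /(_ Js (@beta_conn _) JsJ)] := ZiP i.
  have dZi : [disjoint Js & Zi i].
    apply: disjointWr (beta_disjoint (Zs :|: Z0)).
    apply: subset_trans (subsetUl _ _); apply: subset_trans (subsetUr _ _).
    exact: bigcup_sup.
  case/(_ dZi) => [dA|]; last exact.
  case: (nW i); exists Zs; split=> // x h xZs hW [hx [Q [cQ sQ dQ mQ pQ]]].
  have /negP/not_disjoint[p pQ' /bigcupP[c cJs pc]] := mQ.
  have := mem_disjointF dA cJs; rewrite inE (subsetP JsJ) //= => /negP; apply.
  apply/asboolP; exists x, h, Q; split; split=> //.
    by apply: contra xZs => xZ; rewrite inE xZ.
  by apply/negP=> d; have := mem_disjointF d pQ'; rewrite pc.
case/choice => P PP.
have : forall i, exists t : V * V * H * {set H},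
    t.1.1.1 \in P i /\ good i t.1.1.1 t.1.1.2 t.1.2 t.2.
  move=> i; have [_ _ _ /negP/not_disjoint[c cP cA] _] := PP i.
  move: cA; rewrite inE => /andP[_ /asboolP[x [h [Q g]]]].
  by exists (c, x, h, Q).
case/choice => t tP.
pose c i := (t i).1.1.1; pose x i := (t i).1.1.2; pose h i := (t i).1.2; pose Q i := (t i).2.
have {}tP i : c i \in P i /\ good i (c i) (x i) (h i) (Q i) := tP i.
have cb i : c i \in beta Z0.
  by have [cP _] := tP i; have [_ /subsetP PJ _ _ _] := PP i; apply: (subsetP J0); apply: PJ.
have adj_cx i : adj (c i) (x i).
  have [cP [[xZ hW hx] [cQ sQ dQ /negP mQ _]]] := tP i; rewrite adjE; apply/andP; split.
    apply/eqP=> E; have := mem_disjointF (beta_avoids (cb i)); rewrite E => /(_ _ hx).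
    by rewrite (subsetP (WU i)).
  have [p pQ pc] := not_disjoint mQ.
  by apply/negP=> d; have := mem_disjointF d pc; rewrite (subsetP sQ).
pose T := \bigcup_i P i.
pose F := T :|: [set x i | i : 'I_3].
have PT i : P i \subset T by apply: bigcup_sup.
have Pconn i : conn adj (P i) by case: (PP i).
have vP i : v \in P i by case: (PP i).
have Tconn : conn adj T.
  by apply: (@conn_bigcup_point _ _ _ _ v).
have /set0Pn[p0 p0v] := R_neq0 v.
have TJ : T \subset J by apply/bigcupsP=> i _; case: (PP i).
exists F, (\bigcup_i (region T :|: Q i)); split.
- have p0T : p0 \in region T.
    by apply/bigcupP; exists v => //; apply: (subsetP (PT ord0)).
  apply: (@conn_bigcup_point _ _ _ _ p0) => [i|i]; last by rewrite inE p0T.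
  have [cP [_ [cQ _ _ /negP mQ _]]] := tP i.
  apply: connUI => //; first exact: region_conn.
  have [p pQ pc] := not_disjoint mQ; apply/set0Pn; exists p; rewrite inE pQ andbT.
  by apply/bigcupP; exists (c i) => //; apply: (subsetP (PT i)).
- apply/bigcupsP=> i _; rewrite subUset regionS ?subsetUl //=.
  have [_ [_ [_ sQ _ _ _]]] := tP i; apply: subset_trans sQ _.
  by apply: bigcup_sup; rewrite !inE imset_f ?orbT.
- apply: disjoint_intro => p /bigcupP[i _ /setUP[/bigcupP[w wT pw]|pQ]] pU.
    have := mem_disjointF (beta_avoids (subsetP J0 _ (subsetP TJ _ wT))) pw.
    by rewrite pU.
  by have [_ [_ [_ _ dQ _ _]]] := tP i; have := mem_disjointF dQ pQ; rewrite pU.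
- move=> i; have [_ [[_ hW _] [_ _ _ _ [p pQ ph]]]] := tP i.
  exists p; last by exists (h i).
  by apply/bigcupP; exists i; rewrite // inE pQ orbT.
split.
- apply: disjoint_intro => w /setUP[/(subsetP TJ) wJ|/imsetP[i _ ->]].
    by apply/negP; exact: mem_disjointF JZ wJ.
  by have [_ [[/negP]]] := tP i.
- have sub : nbrs adj F \subset \bigcup_i (nbrs adj (P i) :|: nbr adj (x i)).
    apply/bigcupsP=> w /setUP[/bigcupP[i _ wP]|/imsetP[i _ ->]];
      apply/subsetP=> u uw; apply/bigcupP; exists i => //; rewrite inE.
      by apply/orP; left; apply/bigcupP; exists w.
    by rewrite uw orbT.
  apply: leq_trans (subset_leq_card sub) _; apply: leq_trans (card_bigcup_le _ _) _.
  have -> : 9 * q = \sum_(i : 'I_3) 3 * q by rewrite sum_nat_const card_ord; lia.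
  apply: leq_sum => i _; apply: leq_trans (leq_card_setU _ _) _.
  have : #|nbrs adj (P i)| <= 2 * q.
    by apply: leq_trans (card_nbrs _ _) _; case: (PP i).
  have : #|nbr adj (x i)| <= q.
    have [_ [[xZ _ _] _]] := tP i; rewrite leqNgt; apply: contra xZ => lt.
    by apply: (subsetP hZ); rewrite inE.
  by lia.
(* Every vertex of [F] has a neighbour in [F], so deleting [nbrs adj F] deletes [F] as well. *)
- apply/subsetP=> w /setUP[/bigcupP[i _ wP]|/imsetP[i _ ->]]; last first.
    apply/bigcupP; exists (c i); last by rewrite inE adj_cx.
    by rewrite inE (subsetP (PT i)) //; case: (tP i).
  have [->|wc] := eqVneq w (c i).
    apply/bigcupP; exists (x i); last by rewrite inE meet_sym adj_cx.
    by rewrite !inE imset_f ?orbT.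
  have cw : c i \notin [set w] by rewrite inE eq_sym.
  have sw : [set w] \subset P i by rewrite sub1set.
  have [a [b [/set1P-> bP _ wb]]] := conn_cross (Pconn i) sw (set11 w) (proj1 (tP i)) cw.
  apply/bigcupP; exists b; last by rewrite inE meet_sym.
  by rewrite inE (subsetP (PT i)).
Qed.

Lemma disjoint_region (F F' : {set V}) : F \subset nbrs adj F ->
  [disjoint F' & nbrs adj F] -> [disjoint region F & region F'].
Proof.
move=> sF dF; apply: disjoint_intro => p /bigcupP[f fF pf] /bigcupP[f' fF' pf'].
have /negP := mem_disjointF dF fF'; apply.
have [->|ff'] := eqVneq f' f; first exact: (subsetP sF).
apply/bigcupP; exists f => //; rewrite inE adjE eq_sym ff' /=.
by apply/negP=> d; have := mem_disjointF d pf; rewrite pf'.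
Qed.

Lemma landing_absurd : False.
Proof.
have [W [cW WU dW nW]] := three_arcs.
have leh := card_heavy.
(* The successive deleted sets have at most [2 * q], [11 * q] and [20 * q] vertices; the last is the
   limit in [light_link]. *)
have [|F1 [Q1 [cQ1 sQ1 dQ1 tQ1 [dF1 leF1 sF1]]]] := light_link WU nW (subxx _).
  by lia.
have [||F2 [Q2 [cQ2 sQ2 dQ2 tQ2 [dF2 leF2 sF2]]]] :=
    @light_link W (heavy :|: nbrs adj F1) WU nW.
- exact: subsetUl.
- by apply: leq_trans (leq_card_setU _ _) _; lia.
have [||F3 [Q3 [cQ3 sQ3 dQ3 tQ3 [dF3 leF3 sF3]]]] :=
    @light_link W (heavy :|: nbrs adj F1 :|: nbrs adj F2) WU nW.
- by rewrite -setUA subsetUl.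
- apply: leq_trans (leq_card_setU _ _) _.
  have : #|heavy :|: nbrs adj F1| <= 11 * q.
    by apply: leq_trans (leq_card_setU _ _) _; lia.
  by lia.
have d12 : [disjoint Q1 & Q2].
  apply: disjointWl sQ1 _; apply: disjointWr sQ2 _; apply: disjoint_region => //.
  by apply: disjointWr dF2; apply: subsetUr.
have d13 : [disjoint Q1 & Q3].
  apply: disjointWl sQ1 _; apply: disjointWr sQ3 _; apply: disjoint_region => //.
  by apply: disjointWr dF3; rewrite -setUA setUCA subsetUl.
have d23 : [disjoint Q2 & Q3].
  apply: disjointWl sQ2 _; apply: disjointWr sQ3 _; apply: disjoint_region => //.
  by apply: disjointWr dF3; apply: subsetUr.
apply: (@K33_free (fun i : 'I_3 => nth set0 [:: Q1; Q2; Q3] i) W) => //.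
- by case=> [[|[|[|]]] ?].
- by case=> [[|[|[|//]]] ?] [[|[|[|//]]] ?] //=; rewrite disjoint_sym.
- by case=> [[|[|[|//]]] ?] j /=; apply: disjointWr (WU j) _.
- by case=> [[|[|[|//]]] ?] j /=.
Qed.

End Landing.

Lemma core_absurd : False.
Proof.
have [U [Z0 [[cU /andP[gt le]] dU oU mU]]] := core_frame.
exact: (@landing_absurd U Z0).
Qed.

End Core.

(** * Balanced partitions *)

From mathcomp Require Import all_order all_algebra ring lra.
Import Order.TTheory GRing.Theory Num.Theory.

(* Choosing the signs one after the other, so that the new vector makes an
   obtuse angle with the sum of the previous ones. *)
Lemma balanced_signs (I : eqType) (s : seq I) (x y : I -> int) : uniq s ->
  exists f : I -> bool,
    ((\sum_(i <- s) (if f i then x i else - x i)) ^+ 2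
      + (\sum_(i <- s) (if f i then y i else - y i)) ^+ 2
      <= \sum_(i <- s) (x i ^+ 2 + y i ^+ 2))%R.
Proof.
elim: s => [_|i s IH /= /andP[is_ us]].
  by exists xpredT; rewrite !big_nil expr0n addr0.
have [f le] := IH us.
set X := (\sum_(i <- s) (if f i then x i else - x i))%R in le.
set Y := (\sum_(i <- s) (if f i then y i else - y i))%R in le.
exists (fun j => if j == i then (X * x i + Y * y i <= 0)%R else f j).
rewrite !big_cons eqxx.
have E (z : I -> int) b : (\sum_(j <- s) (if if j == i then b else f j then z j else - z j))%R
    = (\sum_(j <- s) (if f j then z j else - z j))%R.
  by apply: eq_big_seq => j js; case: eqP => // ji; rewrite -ji js in is_.
rewrite !E -/X -/Y; move: (bigop _ _ _) le => m le.
have sq a b : ((a + X) ^+ 2 + (b + Y) ^+ 2 =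
    a ^+ 2 + b ^+ 2 + (X ^+ 2 + Y ^+ 2) + (X * a + Y * b) *+ 2)%R.
  by ring.
have [H|H] := leP (X * x i + Y * y i)%R 0%R; rewrite sq; first by lia.
by rewrite !sqrrN !mulrN; lia.
Qed.

Section Separate.
Variables (V : finType) (adj : rel V) (q : nat).
Hypothesis strings : grid_strings adj.
Hypothesis q_gt0 : 0 < q.
Hypothesis deg_sum : \sum_v deg adj v <= 2 * q ^ 2.

Lemma strings_sym : symmetric adj.
Proof. by case: strings => N [R [E _ _]] u v; rewrite !E eq_sym disjoint_sym. Qed.

Lemma halving_separator (w : V -> nat) : exists Z : {set V}, #|Z| <= 430 * q /\
  forall A, conn adj A -> [disjoint A & Z] -> 2 * \sum_(v in A) w v <= \sum_v w v.
Proof.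
apply: contrapT => no; case: strings => N [R [E Rc R0]].
pose big (A : {set V}) := \sum_v w v < 2 * \sum_(v in A) w v.
apply: (core_absurd E (@gadj_sym N) (@gadj_deg N) (@grid_conn N) Rc R0
  (@grid_K33_free N) q_gt0 deg_sum (big := big)).
- move=> A B AB bA; apply: leq_trans bA _; rewrite leq_mul2l /=.
  exact: sum_subset.
- move=> A B bA bB; apply/negP=> /eqP AB0; move: bA bB; rewrite /big.
  have : \sum_(v in A) w v + \sum_(v in B) w v <= \sum_v w v.
    apply: leq_trans (sum_sub_total w (A :|: B)).
    rewrite [leqRHS](big_setID A) (setIidPr (subsetUl _ _)) leq_add2l.
    apply: sum_subset; apply/subsetP=> v vB; rewrite !inE vB orbT andbT.
    by apply/negP=> vA; have := in_set0 v; rewrite -AB0 inE vA vB.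
  by lia.
- move=> Z leZ; apply: contrapT => nA; apply: no; exists Z; split=> // A cA dA.
  by rewrite leqNgt; apply/negP=> bA; apply: nA; exists A.
Qed.

(** Only components with more than $2^{-(k+1)}$ of the total weight need another halving. Being
    disjoint, there are at most $2^{k+1}$ of them, and each is halved with the weight restricted to
    it. The costs form a geometric series. *)
Lemma power_separator (w : V -> nat) k : exists Z : {set V}, #|Z| <= 430 * q * 2 ^ k.+1 /\
  forall A, conn adj A -> [disjoint A & Z] -> 2 ^ k * \sum_(v in A) w v <= \sum_v w v.
Proof.
elim: k => [|k [Z [leZ sepZ]]].
  exists set0; rewrite cards0; split=> // A _ _; rewrite expn0 mul1n.
  exact: sum_sub_total.
pose C := component adj (~: Z).
pose wt (A : {set V}) := \sum_(v in A) w v.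
pose K : {set {set V}} := [set C x | x in ~: Z & \sum_v w v < 2 ^ k.+1 * wt (C x)].
have Ccl x y : x \in ~: Z -> C x :&: C y != set0 -> C x = C y.
  move=> xZ meet; have yZ : y \in ~: Z.
    apply: contraNT meet => yZ; rewrite -subset0; apply/subsetP => z /setIP[_].
    by case/bigcupP=> B /asboolP[_ yB /subsetP/(_ y yB)]; rewrite (negbTE yZ).
  apply/eqP; rewrite eqEsubset; apply/andP; split.
    by apply: component_meet => //; [exact: component_conn|exact: component_sub].
  by apply: component_meet => //; [exact: component_conn|exact: component_sub|rewrite setIC].
have trivK : trivIset K.
  apply/trivIsetP => A B /imsetP[x + ->] /imsetP[y _ ->] AB.
  rewrite inE => /andP[xZ _]; rewrite -setI_eq0; apply: contraNT AB => meet.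
  by apply/eqP; apply: Ccl.
have wK : \sum_(A in K) wt A <= \sum_v w v.
  by rewrite /wt -big_trivIset // sum_sub_total.
have cardK : #|K| <= 2 ^ k.+1.
  have [->|/set0Pn[A0 /imsetP[x + _]]] := eqVneq K set0; first by rewrite cards0.
  rewrite inE => /andP[_ w0].
  have w_gt0 : 0 < \sum_v w v.
    rewrite lt0n; apply/eqP=> E; move: w0; rewrite E.
    rewrite /wt big1 ?muln0 // => v _; apply/eqP.
    by move/eqP: E; rewrite sum_nat_eq0 => /forallP/(_ v).
  rewrite -(leq_pmul2r w_gt0); apply: leq_trans (leq_mul (leqnn (2 ^ k.+1)) wK).
  rewrite [leqRHS]big_distrr /= -sum_nat_const; apply: leq_sum => A /imsetP[y + ->].
  by rewrite inE => /andP[_ /ltnW].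
have [ZK ZKP] := choice (fun A : {set V} =>
  halving_separator (fun v => if v \in A then w v else 0)).
exists (Z :|: \bigcup_(A in K) ZK A); split.
  apply: leq_trans (leq_card_setU _ _) _.
  have : #|\bigcup_(A in K) ZK A| <= 2 ^ k.+1 * (430 * q).
    apply: leq_trans (card_bigcup_le _ _) _; apply: leq_trans (_ : #|K| * (430 * q) <= _).
      by rewrite -sum_nat_const; apply: leq_sum => A _; case: (ZKP A).
    by rewrite leq_mul2r cardK orbT.
  rewrite (expnS 2 k.+1); move: leZ; move: (2 ^ k.+1); nia.
move=> A cA dA.
have [->|/set0Pn[a aA]] := eqVneq A set0; first by rewrite big_set0 muln0.
have AZ : A \subset ~: Z.
  by rewrite -disjoints_subset; apply: disjointWr dA; apply: subsetUl.
have AC : A \subset C a by apply: sub_component.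
have aZ := subsetP AZ _ aA.
have [CK|CK] := boolP (C a \in K); last first.
  move: CK; apply: contraNT; rewrite -ltnNge => lt; apply/imsetP; exists a => //.
  rewrite inE aZ /=; apply: leq_trans lt _; rewrite leq_mul2l; apply/orP; right.
  exact: sum_subset.
have [_ /(_ A cA)] := ZKP (C a).
have d : [disjoint A & ZK (C a)].
  by apply: disjointWr dA; apply: subset_trans (subsetUr _ _); apply: bigcup_sup.
move/(_ d); rewrite -big_mkcond /=.
have -> : \sum_(v in A) (if v \in C a then w v else 0) = \sum_(v in A) w v.
  by apply: eq_bigr => v /(subsetP AC) ->.
have := sepZ (C a) (@component_conn _ _ _ _).
have dC : [disjoint C a & Z] by rewrite disjoints_subset; exact: component_sub.
move/(_ dC); rewrite expnS; move: (2 ^ k); nia.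
Qed.

(** Each component has shares of at most $1/32$ in the vertices and in the degree sum. The squares
    of all shares add up to at most $1/32 + 1/32 = 1/16$, so suitable signs leave a difference of at
    most $1/4$ in each measure, and $(1 + 1/4)/2 = 5/8$. *)
Lemma balanced_partition : 0 < \sum_v deg adj v -> exists S V1 V2 : {set V},
  [/\ #|S| <= 128 * (430 * q),
      [/\ V1 :|: V2 :|: S = setT, [disjoint V1 & V2], [disjoint V1 & S]
        & [disjoint V2 & S]],
      forall x y, x \in V1 -> y \in V2 -> ~~ adj x y,
      8 * #|V1| <= 5 * #|V| /\ 8 * #|V2| <= 5 * #|V|
    & 8 * \sum_(v in V1) deg adj v <= 5 * \sum_v deg adj v /\
      8 * \sum_(v in V2) deg adj v <= 5 * \sum_v deg adj v].
Proof.
set D := \sum_v deg adj v => D0.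
(* The exponent 5 gives the share $1/32$; each of the two separators costs [64 * (430 * q)]. *)
have [S1 [le1 sep1]] := power_separator (fun=> 1) 5.
have [S2 [le2 sep2]] := power_separator (deg adj) 5.
pose S := S1 :|: S2; pose C := component adj (~: S).
pose K : {set {set V}} := [set C x | x in ~: S].
have KP A : A \in K -> [/\ conn adj A, [disjoint A & S1] & [disjoint A & S2]].
  case/imsetP=> x _ ->; split; first exact: component_conn.
    by rewrite disjoints_subset; apply: subset_trans (component_sub _ _ _) _; rewrite setCS subsetUl.
  by rewrite disjoints_subset; apply: subset_trans (component_sub _ _ _) _; rewrite setCS subsetUr.
have trivK : trivIset K.
  apply/trivIsetP => A B /imsetP[x xS ->] /imsetP[y yS ->] AB.
  rewrite -setI_eq0; apply: contraNT AB => meet.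
  rewrite eqEsubset; apply/andP; split.
    by apply: component_meet => //; [exact: component_conn|exact: component_sub].
  by apply: component_meet => //; [exact: component_conn|exact: component_sub|rewrite setIC].
pose wt (w : V -> nat) (A : {set V}) := \sum_(v in A) w v.
(* Cross-multiplied, so that both measures are integers compared with the same total [#|V| * D]. *)
pose x (A : {set V}) : int := Posz (wt (fun=> 1) A * D).
pose y (A : {set V}) : int := Posz (wt (deg adj) A * #|V|).
have [f fle] := balanced_signs x y (enum_uniq K).
pose K' b := [set A in K | f A == b].
pose W b := cover (K' b).
have trivK' b : trivIset (K' b).
  by apply: trivIsetS trivK; apply/subsetP=> A; rewrite inE => /andP[].
have W_disj : [disjoint W true & W false].
  apply: disjoint_intro => v /bigcupP[A + vA] /bigcupP[B + vB].
  rewrite !inE => /andP[AK /eqP fA] /andP[BK /eqP fB].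
  have AB : A != B by apply/eqP=> E; move: fA; rewrite E fB.
  have /trivIsetP/(_ A B AK BK AB) d := trivK.
  by have := mem_disjointF d vA; rewrite vB.
have W_S b : [disjoint W b & S].
  rewrite disjoints_subset; apply/bigcupsP=> A; rewrite inE => /andP[/imsetP[z _ ->] _].
  exact: component_sub.
have W_cover v : v \notin S -> v \in W (f (C v)).
  move=> vS; have vS' : v \in ~: S by rewrite inE.
  apply/bigcupP; exists (C v); last exact: mem_component.
  by rewrite inE eqxx andbT imset_f.
have W_adj u v : u \in W true -> v \in W false -> ~~ adj u v.
  move=> /bigcupP[A + uA] vW; rewrite inE => /andP[/imsetP[z zS E] /eqP fA].
  apply/negP=> uv; have vS : v \in ~: S by rewrite inE (mem_disjointF (W_S false) vW).
  have vA : v \in A by rewrite E in uA *; apply: component_adj uA vS uv; exact: strings_sym.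
  suff vW1 : v \in W true by have := mem_disjointF W_disj vW1; rewrite vW.
  by apply/bigcupP; exists A => //; rewrite inE E imset_f // -E fA.
pose M : nat := #|V| * D.
have square_le w (c : nat) : (forall A, A \in K -> 32 * wt w A <= \sum_v w v) ->
    (\sum_v w v) * c = M ->
    (32%:R * \sum_(A <- enum K) (Posz (wt w A * c)) ^+ 2 <= Posz M ^+ 2)%R.
  move=> small totc.
  have tot : \sum_(A in K) wt w A <= \sum_v w v.
    by rewrite /wt -big_trivIset // sum_sub_total.
  apply: (@le_trans _ _ (Posz (M * \sum_(A in K) (wt w A * c)))).
    rewrite big_enum /= mulr_sumr PoszM raddf_sum /= mulr_sumr.
    apply: ler_sum => A AK; have : 32 * (wt w A * c) <= M.
      by rewrite mulnA -totc leq_mul2r small ?orbT.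
    by rewrite expr2; move: (wt w A * c); nia.
  rewrite -big_distrl /= expr2 -PoszM lez_nat leq_mul2l; apply/orP; right.
  by rewrite -totc leq_mul2r tot orbT.
have split_signs w (c : nat) :
    (\sum_(A <- enum K) (if f A then Posz (wt w A * c) else - Posz (wt w A * c)) =
     Posz c * (Posz (wt w (W true)) - Posz (wt w (W false))))%R.
  have wtW b : wt w (W b) = \sum_(A in K' b) wt w A by rewrite /wt -big_trivIset.
  rewrite mulrBr !wtW -!PoszM !big_distrr /= big_enum (bigID f) /=.
  rewrite !(raddf_sum Posz) /= -sumrN.
  congr (_ + _)%R.
    apply: eq_big => A; first by rewrite inE eqb_id.
    by case/andP=> _ ->; rewrite mulnC.
  apply: eq_big => A; first by rewrite inE eqbF_neg.
  by case/andP=> _ /negbTE->; rewrite mulnC.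
have conclude w (c : nat) : 0 < c -> (\sum_v w v) * c = M ->
    (16%:R * (\sum_(A <- enum K) (if f A then Posz (wt w A * c) else - Posz (wt w A * c))) ^+ 2
       <= Posz M ^+ 2)%R -> forall b, 8 * wt w (W b) <= 5 * \sum_v w v.
  move=> c0 totc; rewrite split_signs.
  have tot : wt w (W true) + wt w (W false) <= \sum_v w v.
    apply: leq_trans (sum_sub_total w (W true :|: W false)).
    rewrite [leqRHS](big_setID (W true)) (setIidPr (subsetUl _ _)) leq_add2l.
    apply: sum_subset; apply/subsetP=> v vB; rewrite !inE vB orbT andbT.
    by apply/negP=> /(mem_disjointF W_disj); rewrite vB.
  have half (a a' : nat) : (16%:R * (Posz c * (Posz a - Posz a')) ^+ 2 <= Posz M ^+ 2)%R ->
      4 * a <= \sum_v w v + 4 * a'.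
    move: totc; move: (\sum_v w v) => t <-; rewrite PoszM => sq; rewrite leqNgt; apply/negP=> lt.
    have {lt} : (Posz t + 1 <= 4%:R * (Posz a - Posz a'))%R by lia.
    move: sq; move: (Posz a - Posz a')%R => d; rewrite leNgt => /negP sq lt; apply: sq.
    have lt' : (Posz t * Posz c < 4%:R * (Posz c * d))%R by nia.
    have -> : (16%:R * (Posz c * d) ^+ 2 = (4%:R * (Posz c * d)) ^+ 2)%R by rewrite [RHS]exprMn.
    by rewrite ltr_pXn2r ?nnegrE //; lia.
  move=> sq b; have h1 := half _ _ sq.
  have h2 : 4 * wt w (W false) <= \sum_v w v + 4 * wt w (W true).
    by apply: half; rewrite -(opprB (Posz (wt w (W true)))) mulrN sqrrN.
  by case: b; lia.
have wt1 A : wt (fun=> 1) A = #|A| by rewrite /wt sum1_card.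
have tot1 : \sum_(v : V) 1 = #|V| by rewrite sum1_card.
have n_gt0 : 0 < #|V|.
  rewrite lt0n; apply/eqP=> /card0_eq V0; move: D0; rewrite /D big1 // => v.
  by have := V0 v.
have sqx : (32%:R * \sum_(A <- enum K) x A ^+ 2 <= Posz M ^+ 2)%R.
  apply: square_le => [A /KP[cA dA _]|]; last by rewrite tot1.
  exact: sep1 A cA dA.
have sqy : (32%:R * \sum_(A <- enum K) y A ^+ 2 <= Posz M ^+ 2)%R.
  apply: square_le => [A /KP[cA _ dA]|]; last by rewrite mulnC.
  exact: sep2 A cA dA.
rewrite big_split /= in fle.
have cx : forall b, 8 * wt (fun=> 1) (W b) <= 5 * \sum_(v : V) 1.
  apply: (conclude _ D) => //; first by rewrite tot1.
  move: sqx sqy fle; rewrite /x.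
  do 4!move: (bigop _ _ _); move=> ????.
  nia.
have cy : forall b, 8 * wt (deg adj) (W b) <= 5 * D.
  apply: (conclude _ #|V|) => //; first by rewrite mulnC.
  move: sqx sqy fle; rewrite /y.
  do 4!move: (bigop _ _ _); move=> ????.
  nia.
exists S, (W true), (W false); split => //.
- by apply: leq_trans (leq_card_setU _ _) _; move: le1 le2; rewrite (_ : 2 ^ 6 = 64) //; lia.
- split => //; apply/setP=> v; rewrite in_setT in_setU.
  have [vS|/W_cover] := boolP (v \in S); first by rewrite orbT.
  by rewrite orbF in_setU; case: (f _) => ->; rewrite ?orbT.
- by move: (cx true) (cx false); rewrite !wt1 tot1.
- by split; [exact: (cy true)|exact: (cy false)].
Qed.

End Separate.

(** * From curves to the grid *)

Section Cells.
Variables (V : finType) (adj : rel V) (N : nat) (I : Type) (D : I -> Prop).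
Variables (cx cy : V -> I -> nat).
Hypothesis adj_irr : irreflexive adj.

Definition near_cells v s t : Prop :=
  (cx v s <= (cx v t).+1 /\ cx v t <= (cx v s).+1) /\
  (cy v s <= (cy v t).+1 /\ cy v t <= (cy v s).+1).

Local Notation P := ('I_N * 'I_N)%type.

(** A cell is represented by its four corners, and a curve by the corners of all cells that it
    visits. *)
Definition corner v t (i j : nat) : Prop :=
  cx v t <= i <= (cx v t).+1 /\ cy v t <= j <= (cy v t).+1.

Hypothesis D_inh : exists t, D t.
Hypothesis bounded : forall v t, D t -> (cx v t).+1 < N /\ (cy v t).+1 < N.
(** Stands in for continuity together with connectedness of the parameter interval. *)
Hypothesis chained : forall v (Q : I -> Prop),
  (forall s t, D s -> D t -> near_cells v s t -> Q s -> Q t) ->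
  forall s t, D s -> D t -> Q s -> Q t.
Hypothesis adj_cell : forall u v, adj u v -> exists s t,
  [/\ D s, D t, cx u s = cx v t & cy u s = cy v t].
Hypothesis nadj_cell : forall u v s t i j, u != v -> ~~ adj u v -> D s -> D t ->
  corner u s i j -> corner v t i j -> False.

Definition cell_region v : {set P} :=
  [set p : P | `[< exists t, D t /\ corner v t p.1 p.2 >]].

(** The corners of one cell form a 4-cycle, and near cells share the corner whose coordinates are
    the maxima of theirs. *)
Lemma cell_region_conn v : conn (@gadj N) (cell_region v).
Proof.
move=> B sB /set0Pn[b bB] cl.
have link (p q : P) t : D t -> corner v t p.1 p.2 -> corner v t q.1 q.2 ->
    p \in B -> q \in B.
  move=> Dt cp cq pB.
  pose r : P := (q.1, p.2).
  have cr : corner v t r.1 r.2 by case: cp cq => [? ?] [].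
  have inR (x : P) : corner v t x.1 x.2 -> x \in cell_region v.
    by move=> cxx; rewrite inE; apply/asboolP; exists t.
  have rB : r \in B.
    have [e|ne] := eqVneq (p.1 : nat) q.1; first by rewrite -(@eqP_nat _ p r).
    apply: (cl p) => //; first exact: inR.
    by rewrite /gadj eqxx /=; case: cp cq => [cp _] [cq _]; lia.
  have [e|ne] := eqVneq (p.2 : nat) q.2; first by rewrite -(@eqP_nat _ r q).
  apply: (cl r) => //; first exact: inR.
  by rewrite /gadj eqxx /=; case: cp cq => [_ cp] [_ cq]; lia.
pose Q t := exists2 p : P, p \in B & corner v t p.1 p.2.
have [t0 [D0 c0]] : exists t, D t /\ corner v t b.1 b.2.
  by have := subsetP sB b bB; rewrite inE => /asboolP.
apply/subsetP=> p; rewrite inE => /asboolP[t [Dt ct]].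
have [q qB cq] : Q t; last exact: link cq ct qB.
apply: (chained (v := v) (Q := Q)) D0 Dt _; last by exists b.
move=> s t' Ds Dt' [[n1 n2] [n3 n4]] [p' pB cp'].
have [bs1 bs2] := bounded v Ds; have [bt1 bt2] := bounded v Dt'.
have li : maxn (cx v s) (cx v t') < N by lia.
have lj : maxn (cy v s) (cy v t') < N by lia.
exists (Ordinal li, Ordinal lj); last by split=> /=; lia.
by apply: link cp' _ pB => //; split=> /=; lia.
Qed.

Lemma grid_of_cells : grid_strings adj.
Proof.
exists N, cell_region; split; last 2 first.
- exact: cell_region_conn.
- move=> v; have [t Dt] := D_inh; have [b1 b2] := bounded v Dt.
  apply/set0Pn; exists (Ordinal (ltnW b1), Ordinal (ltnW b2)).
  by rewrite inE; apply/asboolP; exists t; split=> //; split=> /=; lia.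
move=> u v; have [->|uv] := eqVneq u v; first by rewrite adj_irr.
apply/idP/idP => [/adj_cell[s [t [Ds Dt ex ey]]]|].
  have [b1 b2] := bounded u Ds; apply/negP.
  move=> /mem_disjointF/(_ (_ : (Ordinal (ltnW b1), Ordinal (ltnW b2)) \in _)).
  have H (w : V) r : D r -> cx u s = cx w r -> cy u s = cy w r ->
      (Ordinal (ltnW b1), Ordinal (ltnW b2)) \in cell_region w.
    move=> Dr e1 e2; rewrite inE; apply/asboolP; exists r; split=> //.
    by split=> /=; rewrite -?e1 -?e2; lia.
  by move=> /(_ (H u s Ds erefl erefl)) /negP; apply; apply: H ex ey.
move=> /negP/not_disjoint[p]; rewrite !inE => /asboolP[s [Ds cs]] /asboolP[t [Dt ct]].
apply: contrapT => /negP nadj; exact: nadj_cell uv nadj Ds Dt cs ct.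
Qed.

End Cells.

From mathcomp Require Import all_classical all_reals all_analysis.
Import numFieldNormedType.Exports.
Local Open Scope ring_scope.

(** * Uniform estimates for curves by compactness *)

Section Curves.
Variable R : realType.

Definition unit_itv (t : R) : Prop := 0 <= t <= 1.

Lemma unit_itv_uniform (P : R -> R -> Prop) :
  (forall t, unit_itv t -> exists2 d, 0 < d &
     forall e t', 0 < e < d -> unit_itv t' -> `|t - t'| < d -> P e t') ->
  exists2 d, 0 < d & forall e t, 0 < e < d -> unit_itv t -> P e t.
Proof.
move=> loc.
have /compact_near_coveringP/near_covering_withinP cov := @segment_compact R 0 1.
have : \forall e \near at_right (0 : R), (`[0, 1] `<=` P e)%classic.
  apply: cov => t; rewrite /= in_itv /= => /loc[d d0 H].
  exists (ball t d, [set e | 0 < e < d]%classic).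
    split=> /=; first exact: nbhsx_ballx.
    by near=> e; apply/andP; split; near: e; [exact: nbhs_right_gt|exact: nbhs_right_lt].
  by move=> [t' e] /= [tt' ed]; rewrite in_itv /= => t'01; apply: H.
rewrite near_withinE => -[d d0 H]; exists d => // e t /andP[e0 ed] t01.
by apply: (H e _ e0); rewrite /= ?in_itv //= sub0r normrN gtr0_norm.
Unshelve. all: by end_near. Qed.

Lemma curve_cont (g : R -> R * R) : is_curve g -> forall t e, unit_itv t -> 0 < e ->
  exists2 d, 0 < d & forall t', unit_itv t' -> `|t - t'| < d ->
    `|(g t).1 - (g t').1| < e /\ `|(g t).2 - (g t').2| < e.
Proof.
move=> /subspace_continuousP cg t e t01 e0.
have t01' : `[0, 1]%classic t by rewrite /= in_itv.
have := cg t t01' _ (nbhsx_ballx (g t) e e0).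
rewrite /nbhs /= /within /= => -[d /= d0 H]; exists d => // t' t'01 tt'.
by have [] := H t' tt' (_ : `[0, 1]%classic t'); rewrite ?in_itv.
Qed.

Lemma unit_itv_chain (Q : R -> Prop) (e s t : R) : 0 < e ->
  (forall s t, unit_itv s -> unit_itv t -> `|s - t| < e -> Q s -> Q t) ->
  unit_itv s -> unit_itv t -> Q s -> Q t.
Proof.
move=> e0 H s01 t01.
have [n] : exists n : nat, `|s - t| <= n%:R * (e / 2).
  exists (Num.truncn (`|s - t| / (e / 2))).+1.
  by rewrite -ler_pdivrMr ?divr_gt0 // ltW // truncnS_gt.
elim: n s s01 => [|n IH] s s01 le Qs.
  by apply: (H s) => //; apply: le_lt_trans le _; rewrite mul0r.
have [lt|ge] := ltP `|s - t| e; first exact: (H s).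
rewrite -natr1 mulrDl mul1r in le.
have [st|ts] := leP s t.
  have E : `|s - t| = t - s by rewrite distrC ger0_norm // subr_ge0.
  rewrite E in le ge; rewrite /unit_itv in s01 t01.
  have s'01 : unit_itv (s + e / 2) by rewrite /unit_itv; lra.
  apply: (IH (s + e / 2)) => //.
    by rewrite distrC ger0_norm; lra.
  by apply: (H s) => //; rewrite opprD addrA subrr sub0r normrN gtr0_norm; lra.
have E : `|s - t| = s - t by rewrite gtr0_norm // subr_gt0.
rewrite E in le ge; rewrite /unit_itv in s01 t01.
have s'01 : unit_itv (s - e / 2) by rewrite /unit_itv; lra.
apply: (IH (s - e / 2)) => //.
  by rewrite ger0_norm; lra.
by apply: (H s) => //; rewrite opprB addrC subrK gtr0_norm; lra.
Qed.

Lemma common_eps (I : finType) (P : I -> R -> Prop) :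
  (forall i, exists2 d, 0 < d & forall e, 0 < e < d -> P i e) ->
  exists2 d, 0 < d & forall i e, 0 < e < d -> P i e.
Proof.
move=> H.
suff [d d0 Hd] : exists2 d, 0 < d & forall i, i \in enum I -> forall e, 0 < e < d -> P i e.
  by exists d => // i; apply: Hd; rewrite mem_enum.
elim: (enum I) => [|i s [d d0 IH]]; first by exists 1.
have [d' d'0 H'] := H i; exists (Num.min d d') => [|j].
  by rewrite lt_min d0.
rewrite inE => js e; rewrite lt_min => /and3P[e0 ed ed'].
by move: js => /orP[/eqP->|js]; [apply: H'|apply: IH => //]; rewrite e0.
Qed.

Definition close (e : R) (p p' : R * R) : Prop := `|p.1 - p'.1| < e /\ `|p.2 - p'.2| < e.

(** Compactness is applied to each curve in turn; the second time the margin [d] is halved to absorb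
    the movement of [g s]. *)
Lemma curves_apart (g g' : R -> R * R) : is_curve g -> is_curve g' ->
  (forall s t, unit_itv s -> unit_itv t -> g s <> g' t) ->
  exists2 d, 0 < d & forall e s t, 0 < e < d -> unit_itv s -> unit_itv t ->
    ~ close e (g s) (g' t).
Proof.
move=> cg cg' disj.
suff [d d0 H] : exists2 d, 0 < d & forall e s, 0 < e < d -> unit_itv s ->
    forall t, unit_itv t -> ~ close e (g s) (g' t).
  by exists d => // e s t ed s01 t01; apply: H.
apply: unit_itv_uniform => s s01.
have [d d0 H] : exists2 d, 0 < d & forall e t, 0 < e < d -> unit_itv t ->
    ~ close e (g s) (g' t).
  apply: unit_itv_uniform => t t01.
  pose m := Num.max `|(g s).1 - (g' t).1| `|(g s).2 - (g' t).2|.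
  have m0 : 0 < m.
    rewrite lt_max !normr_gt0 !subr_eq0 -negb_and; apply/negP=> /andP[/eqP e1 /eqP e2].
    by apply: (disj s t) => //; rewrite (surjective_pairing (g s)) e1 e2 -surjective_pairing.
  have m2 : 0 < m / 2 by rewrite divr_gt0.
  have [d d0 Hd] := curve_cont cg' t01 m2.
  exists (Num.min d (m / 2)); first by rewrite lt_min d0.
  move=> e t' /andP[e0]; rewrite !lt_min => /andP[_ em] t'01 /andP[td _] [c1 c2].
  have [h1 h2] := Hd t' t'01 td.
  have a1 := ler_distD (g' t').1 (g s).1 (g' t).1.
  have a2 := ler_distD (g' t').2 (g s).2 (g' t).2.
  rewrite distrC in h1; rewrite distrC in h2.
  suff : m < m by rewrite ltxx.
  by rewrite {1}/m gt_max; apply/andP; split; lra.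
have d2 : 0 < d / 2 by rewrite divr_gt0.
have [d' d'0 Hd] := curve_cont cg s01 d2.
exists (Num.min d' (d / 2)); first by rewrite lt_min d'0.
move=> e s' /andP[e0]; rewrite !lt_min => /andP[_ ed] s'01 /andP[sd _] t t01 [c1 c2].
have [h1 h2] := Hd s' s'01 sd.
have ed' : 0 < e + d / 2 < d by lra.
apply: (H (e + d / 2) t ed' t01); split.
  have := ler_distD (g s').1 (g s).1 (g' t).1; lra.
have := ler_distD (g s').2 (g s).2 (g' t).2; lra.
Qed.

(** The bound is [e^-1] so that one parameter controls both the mesh and the extent of the grid. *)
Lemma curve_bounded (g : R -> R * R) : is_curve g ->
  exists2 d, 0 < d & forall e t, 0 < e < d -> unit_itv t ->
    `|(g t).1| < e^-1 /\ `|(g t).2| < e^-1.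
Proof.
move=> cg; apply: unit_itv_uniform => t t01.
have [d d0 Hd] := curve_cont cg t01 ltr01.
pose M := `|(g t).1| + `|(g t).2| + 1.
have M0 : 0 < M by rewrite ltr_wpDl // addr_ge0.
exists (Num.min d M^-1); first by rewrite lt_min d0 invr_gt0.
move=> e t' /andP[e0]; rewrite !lt_min => /andP[_ eM] t'01 /andP[td _].
have [h1 h2] := Hd t' t'01 td.
have Me : M < e^-1 by rewrite -(invrK M) ltf_pV2 // posrE invr_gt0.
have a1 := ler_distD (g t).1 (g t').1 0; have a2 := ler_distD (g t).2 (g t').2 0.
rewrite !subr0 in a1 a2; rewrite distrC in h1; rewrite distrC in h2.
have n1 := normr_ge0 (g t).1; have n2 := normr_ge0 (g t).2.
by split; apply: lt_trans Me; rewrite /M; lra.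
Qed.

End Curves.

(** * Rounding curves to cells of a fine grid *)

Section Discretize.
Variable R : realType.

(** Cells have side [e / 2], so points in cells with a common corner differ by less than [e] in each
    coordinate; the shift by [e^-1] keeps the argument of [Num.truncn] nonnegative. *)
Definition scale (e x : R) : R := (x + e^-1) * (2 / e).
Definition cellnum (e x : R) : nat := Num.truncn (scale e x).

Lemma scale_ge0 e x : 0 < e -> `|x| < e^-1 -> 0 <= scale e x.
Proof.
move=> e0; rewrite ltr_norml => /andP[h _]; apply: mulr_ge0; last by rewrite divr_ge0 // ltW.
by lra.
Qed.

Lemma scale_dist e x y : 0 < e -> `|scale e x - scale e y| = `|x - y| * (2 / e).
Proof.
move=> e0; rewrite /scale -mulrBl opprD addrACA subrr addr0 normrM.
by rewrite [X in _ * X]gtr0_norm // divr_gt0.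
Qed.

Lemma cellnum_near e x y : 0 < e -> `|x| < e^-1 -> `|y| < e^-1 ->
  `|x - y| < e / 2 -> (cellnum e x <= (cellnum e y).+1)%N.
Proof.
move=> e0 xe ye xy.
have /andP[x1 _] := truncn_itv (scale_ge0 e0 xe).
have /andP[_ y2] := truncn_itv (scale_ge0 e0 ye).
rewrite leqNgt; apply/negP=> lt.
have : ((cellnum e y).+2%:R : R) <= (cellnum e x)%:R by rewrite ler_nat.
have : `|scale e x - scale e y| < 1.
  by rewrite scale_dist // -ltr_pdivlMr ?divr_gt0 // mul1r invf_div.
rewrite ltr_norml -(natr1 (cellnum e y).+1) /cellnum; lra.
Qed.

Lemma cellnum_corner e x y i : 0 < e -> `|x| < e^-1 -> `|y| < e^-1 ->
  (cellnum e x <= i <= (cellnum e x).+1)%N -> (cellnum e y <= i <= (cellnum e y).+1)%N ->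
  `|x - y| < e.
Proof.
move=> e0 xe ye /andP[x1 x2] /andP[y1 y2].
have /andP[sx1 sx2] := truncn_itv (scale_ge0 e0 xe).
have /andP[sy1 sy2] := truncn_itv (scale_ge0 e0 ye).
have h1 : ((cellnum e x)%:R : R) <= (cellnum e y).+1%:R by rewrite ler_nat; lia.
have h2 : ((cellnum e y)%:R : R) <= (cellnum e x).+1%:R by rewrite ler_nat; lia.
have : `|scale e x - scale e y| < 2.
  rewrite ltr_norml; move: sx1 sx2 sy1 sy2 h1 h2; rewrite /cellnum -!natr1; lra.
by rewrite scale_dist // -ltr_pdivlMr ?divr_gt0 // invf_div mulrCA divff ?mulr1.
Qed.

Lemma cellnum_bound e x : 0 < e -> `|x| < e^-1 ->
  (cellnum e x <= Num.truncn (4 / (e * e)))%N.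
Proof.
move=> e0 xe; apply: le_truncn; rewrite /scale.
have -> : 4 / (e * e) = (e^-1 + e^-1) * (2 / e) by field; rewrite gt_eqF.
rewrite ler_pM2r ?divr_gt0 // lerD2r ltW //.
by apply: le_lt_trans xe; exact: ler_norm.
Qed.

Lemma string_graph_grid (V : finType) (G : sgraph V) :
  string_graph R G -> grid_strings G.
Proof.
move=> [g [cg GE]].
have unit0 : unit_itv (0 : R) by rewrite /unit_itv lexx ler01.
have bnd v : exists2 d, 0 < d & forall e, 0 < e < d -> forall t, unit_itv t ->
    `|(g v t).1| < e^-1 /\ `|(g v t).2| < e^-1.
  by have [d d0 H] := curve_bounded (cg v); exists d => // e ed t; apply: H.
have [d1 d10 H1] := common_eps bnd.
have sep (p : V * V) : exists2 d, 0 < d & forall e, 0 < e < d ->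
    p.1 != p.2 -> ~~ G p.1 p.2 -> forall s t, unit_itv s -> unit_itv t ->
    ~ close e (g p.1 s) (g p.2 t).
  case: p => u v /=; have [->|uv] := eqVneq u v; first by exists 1.
  have [Guv|nG] := boolP (G u v); first by exists 1.
  have [|d d0 H] := curves_apart (cg u) (cg v).
    move=> s t s01 t01 st; case/negP: nG; apply/GE; split; first exact/eqP.
    by exists (g u s); split; [exists s|exists t]; rewrite //= in_itv.
  by exists d => // e ed _ _ s t; apply: H.
have [d2 d20 H2] := common_eps sep.
pose e := Num.min d1 d2 / 2.
have m0 : 0 < Num.min d1 d2 by rewrite lt_min d10.
have e0 : 0 < e by rewrite divr_gt0.
have em : e < Num.min d1 d2 by rewrite /e; lra.
have e1 : 0 < e < d1 by rewrite e0 (lt_le_trans em) // ge_min lexx.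
have e2 : 0 < e < d2 by rewrite e0 (lt_le_trans em) // ge_min lexx orbT.
have bd v t : unit_itv t -> `|(g v t).1| < e^-1 /\ `|(g v t).2| < e^-1 := H1 v e e1 t.
(* The [.+2] leaves room for the upper corners of the last cell. *)
apply: (@grid_of_cells _ _ (Num.truncn (4 / (e * e))).+2 R (@unit_itv R)
  (fun v t => cellnum e (g v t).1) (fun v t => cellnum e (g v t).2)).
- exact: adj_irr.
- by exists 0.
- move=> v t /(bd v)[b1 b2]; split; rewrite !ltnS; exact: cellnum_bound.
- move=> v Q step s t s01 t01.
  have e20 : 0 < e / 2 by rewrite divr_gt0.
  (* Uniform continuity of [g v], with [d'] as the modulus. *)
  have [d d0 H] : exists2 d, 0 < d & forall d' s, 0 < d' < d -> unit_itv s ->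
      forall t, unit_itv t -> `|s - t| < d' -> close (e / 2) (g v s) (g v t).
    apply: unit_itv_uniform => s0 s001.
    have e40 : 0 < e / 2 / 2 by rewrite divr_gt0.
    have [d d0 Hd] := curve_cont (cg v) s001 e40.
    exists (d / 2); first by rewrite divr_gt0.
    move=> d' s1 /andP[d'0 d'd] s101 ss1 t1 t101 st1.
    have [] := Hd s1 s101 (_ : _ < _); first by lra.
    have [|h1 h2 h3 h4] := Hd t1 t101.
      by have := ler_distD s1 s0 t1; lra.
    rewrite distrC in h3; rewrite distrC in h4.
    by split; [have := ler_distD (g v s0).1 (g v s1).1 (g v t1).1
              |have := ler_distD (g v s0).2 (g v s1).2 (g v t1).2]; lra.
  have d2' : 0 < d / 2 by rewrite divr_gt0.
  apply: (unit_itv_chain d2') => // s1 t1 s101 t101 st1; apply: step => //.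
  have dd : 0 < d / 2 < d by lra.
  have [h1 h2] := H _ s1 dd s101 t1 t101 st1.
  have [b1 b2] := bd v s1 s101; have [b3 b4] := bd v t1 t101.
  by split; split; apply: cellnum_near; rewrite // distrC.
- move=> u v /GE[_ [p [[s /= s01 <-] [t /= t01 E]]]].
  by rewrite !in_itv /= in s01 t01; exists s, t; rewrite E.
- move=> u v s t i j uv nG s01 t01 [cs1 cs2] [ct1 ct2].
  apply: (H2 (u, v) e e2 uv nG s t s01 t01).
  have [b1 b2] := bd u s s01; have [b3 b4] := bd v t t01.
  by split; [apply: cellnum_corner cs1 ct1|apply: cellnum_corner cs2 ct2].
Qed.

End Discretize.

(** * Degree sums and numbers of edges *)

Section Edges.
Variables (V : finType) (G : sgraph V).

(** Ordered adjacent pairs map two-to-one onto edges; irreflexivity makes the two orders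
    distinct. *)
Lemma sum_inner_deg (A : {set V}) :
  (\sum_(x in A) \sum_(y in A | G x y) 1 = 2 * #|induced_edges G A|)%N.
Proof.
rewrite pair_big_dep /=.
pose P := [set p : V * V | (p.1 \in A) && ((p.2 \in A) && G p.1 p.2)]%SET.
pose f (p : V * V) : {set V} := [set p.1; p.2]%SET.
have EP : (f @: P)%SET = induced_edges G A.
  apply/setP=> E; apply/imsetP/imset2P => [[[x y]]|[x y xA]].
    by rewrite inE /= => /and3P[xA yA xy] ->; exists x y; rewrite ?inE ?yA.
  by rewrite inE => /andP[yA xy] ->; exists (x, y); rewrite // inE /= xA yA.
rewrite (eq_bigl (mem P)) => [|p]; last by rewrite !inE.
rewrite (partition_big_imset f) /= EP mulnC -sum_nat_const -EP.
apply: eq_bigr => E /imsetP[[x y]]; rewrite inE /= => /and3P[xA yA xy] ->.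
have xy' : x != y by apply/eqP=> e; rewrite e adj_irr in xy.
have -> : 2%N = #|[set (x, y); (y, x)]%SET|.
  by rewrite cards2 xpair_eqE (negbTE xy').
rewrite -sum1_card; apply: eq_bigl => -[a b]; rewrite !inE /= !xpair_eqE.
apply/idP/idP => [/andP[/and3P[_ _ ab] /eqP/setP s]|].
  have := s a; have := s b; rewrite !inE !eqxx ?orbT /=.
  have ab' : a != b by apply/eqP=> e; rewrite e adj_irr in ab.
  move=> /esym/orP[]/eqP eb /esym/orP[]/eqP ea; rewrite ea eb ?eqxx ?orbT //.
    by rewrite ea eb eqxx in ab'.
  by rewrite ea eb eqxx in ab'.
case/orP=> /andP[/eqP-> /eqP->]; first by rewrite xA yA xy eqxx.
by rewrite yA xA adj_sym xy /f /= finset.setUC eqxx.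
Qed.

Lemma sum_deg : (\sum_v deg G v = 2 * #|edges G|)%N.
Proof.
rewrite -sum_inner_deg; apply: eq_big => [v|v _]; first by rewrite inE.
by rewrite /deg /nbr -sum1_card; apply: eq_bigl => u; rewrite !inE.
Qed.

Lemma inner_edges_le (A : {set V}) :
  (2 * #|induced_edges G A| <= \sum_(v in A) deg G v)%N.
Proof.
rewrite -sum_inner_deg; apply: leq_sum => v _.
rewrite /deg /nbr -sum1_card big_mkcond [leqRHS]big_mkcond /=.
by apply: leq_sum => u _; rewrite inE; case: (u \in A); case: (G v u).
Qed.

End Edges.

Theorem theorem8 (R : realType) (r : R) (hr : 2 / 3 < r < 1) :
  exists2 c : R, 0 < c &
    (forall (V : finType) (G : sgraph V), string_graph R G ->
       exists S : {set V},
         #|S|%:R <= c * Num.sqrt #|edges G|%:R /\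
         edge_balanced_separator G r S) /\
    (3 / 4 < r ->
     forall (V : finType) (G : sgraph V), string_graph R G -> #|V| <> 1%N ->
       exists S : {set V},
         [/\ #|S|%:R <= c * Num.sqrt #|edges G|%:R,
             balanced_separator G (2 / 3 : R) S
           & edge_balanced_separator G r S]).
Proof.
(* [128 * 430] comes from [balanced_partition], the factor 2 from $q \le 2\sqrt m$. *)
pose c : R := 128 * 430 * 2.
have c0 : 0 < c by rewrite /c; do ?[apply: mulr_gt0]; rewrite ltr0n.
have main (V : finType) (G : sgraph V) : string_graph R G -> (0 < #|edges G|)%N ->
    exists S : {set V}, [/\ #|S|%:R <= c * Num.sqrt #|edges G|%:R,
      balanced_separator G (2 / 3 : R) S & edge_balanced_separator G r S].
  move=> /string_graph_grid strings m0; set m := #|edges G| in m0 *.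
  (* For the least such [q], $q - 1 < \sqrt m$, and $1 \le \sqrt m$ as there is an edge. *)
  have [q [q0 mq qm]] : exists q, [/\ (0 < q)%N, (m <= q ^ 2)%N & q%:R <= 2 * Num.sqrt m%:R :> R].
    have ex : exists q, (m <= q ^ 2)%N by exists m; rewrite expnS expn1 leq_pmulr.
    case: (ex_minnP ex) => q mq minq.
    have q0 : (0 < q)%N by case: q mq {minq} => //; rewrite leqNgt m0.
    have lt : (q.-1 ^ 2 < m)%N by rewrite ltnNge; apply/negP=> /minq; lia.
    exists q; split=> //; rewrite -(prednK q0) -natr1.
    have h1 : q.-1%:R <= Num.sqrt m%:R :> R.
      rewrite -[leLHS]ger0_norm // -sqrtr_sqr ler_wsqrtr // -natrX ler_nat ltnW //.
    have h2 : 1 <= Num.sqrt m%:R :> R by rewrite -[leLHS]sqrtr1 ler_wsqrtr // ler1n.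
    by lra.
  have degs : (\sum_v deg G v <= 2 * q ^ 2)%N by rewrite sum_deg leq_mul2l mq orbT.
  have degs0 : (0 < \sum_v deg G v)%N by rewrite sum_deg muln_gt0.
  have [S [V1 [V2 [leS [cov d12 d1 d2] nadj [n1 n2] [w1 w2]]]]] :=
    balanced_partition strings q0 degs degs0.
  have sepS : separation G V1 V2 S by split=> // x y; exact: nadj.
  exists S; split.
  - apply: le_trans (_ : (128 * (430 * q))%N%:R <= _); first by rewrite ler_nat.
    have k0 : (0 : R) <= 128 * 430 by apply: mulr_ge0; rewrite ler0n.
    rewrite (natrM R 128 (430 * q)) (natrM R 430 q) (mulrA 128) /c -(mulrA (128 * 430)).
    exact: ler_wpM2l k0 _ _ qm.
  - have half (A : {set V}) : (8 * #|A| <= 5 * #|V|)%N -> #|A|%:R <= 2 / 3 * #|V|%:R :> R.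
      by rewrite -(ler_nat R) !natrM; have := ler0n R #|V|; lra.
    by exists V1, V2; split=> //; apply: half.
  (* An edge inside [A] counts twice in the degree sum over [A], which is at most $5/8$ of $2m$; and
     $5/8 < 2/3 < r$. *)
  - have half (A : {set V}) : (8 * \sum_(v in A) deg G v <= 5 * \sum_v deg G v)%N ->
        #|induced_edges G A|%:R <= r * m%:R.
      rewrite sum_deg => le; have le' := @inner_edges_le V G A.
      have : (8 * #|induced_edges G A| <= 5 * m)%N by rewrite /m; lia.
      rewrite -(ler_nat R) !natrM; have := ler0n R m => mr le2.
      have : 2 / 3 * m%:R <= r * m%:R by rewrite ler_wpM2r //; lra.
      by lra.
    by exists V1, V2; split=> //; apply: half.
have noedge (V : finType) (G : sgraph V) (A : {set V}) :
    #|edges G| = 0%N -> #|induced_edges G A|%:R <= r * #|edges G|%:R.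
  move=> E; have := @inner_edges_le V G A; have : (\sum_(v in A) deg G v <= \sum_v deg G v)%N.
    exact: sum_sub_total.
  rewrite sum_deg E => h1 h2; have -> : #|induced_edges G A| = 0%N by lia.
  by rewrite mulr0.
exists c => //; split => [V G sG|_ V G sG V1].
  have [m0|m0] := posnP #|edges G|; last by have [S [? _ ?]] := main V G sG m0; exists S.
  exists finset.set0; split; first by rewrite cards0 mulr_ge0 ?sqrtr_ge0 // ltW.
  exists [set: V]%SET, finset.set0; split; try exact: noedge.
  split; rewrite ?finset.setU0 // -?setI_eq0 ?finset.setI0 //.
  by move=> x y _; rewrite inE.
have [m0|m0] := posnP #|edges G|; last exact: (main V G sG m0).
have nadj (x y : V) : ~~ G x y.
  apply/negP=> xy; have : [set x; y]%SET \in edges G.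
    by apply/imset2P; exists x y; rewrite ?inE.
  by move/eqP: m0; rewrite cards_eq0 => /eqP->; rewrite inE.
(* Without edges the bound forces an empty separator, so the $n$ vertices are halved; the larger
   half has at most $2n/3$ of them unless $n = 1$. *)
pose W : {set V} := [set x in take (#|V| %/ 2) (enum V)]%SET.
have cW : #|W| = (#|V| %/ 2)%N.
  rewrite cardsE; have /card_uniqP-> : uniq (take (#|V| %/ 2) (enum V)).
    by apply: take_uniq; exact: enum_uniq.
  by rewrite size_takel // -cardE leq_div.
have cW' : #|(~: W)%SET| = (#|V| - #|V| %/ 2)%N by rewrite cardsCs finset.setCK cW.
have sepW : separation G W (~: W)%SET finset.set0.
  split; rewrite ?finset.setU0 ?finset.setUCr // -?setI_eq0 ?finset.setICr ?finset.setI0 //.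
have le23 (k : nat) : (3 * k <= 2 * #|V|)%N -> k%:R <= 2 / 3 * #|V|%:R :> R.
  by rewrite -(ler_nat R) !natrM; lra.
exists finset.set0; split; first by rewrite cards0 mulr_ge0 ?sqrtr_ge0 // ltW.
  by exists W, (~: W)%SET; split=> //; apply: le23; rewrite ?cW ?cW'; lia.
by exists W, (~: W)%SET; split=> //; exact: noedge.
Qed.
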